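(* Let $n\ge f\ge 1$ be integers. There exists a transitive circle exchange transformation of $n$ subintervals with exactly $f$ flips if and only if $n+f\ge 5$.
   Context: Let $S^1=[0,1]/(0\sim 1)$ with the orientation induced by $[0,1]$, and with Lebesgue measure. Let $I_1,\dots,I_n$ be pairwise disjoint open subintervals of $S^1$ whose closures cover $S^1$. An $n$-CET (circle exchange transformation of $n$ subintervals) is an injective map $T:\bigcup_{i=1}^n I_i\to S^1$ which is an isometry on each $I_i$ and which cannot be continuously extended to a larger open subset of $S^1$ (so $T$ has exactly $n$ discontinuity points). A flip of $T$ is a subinterval $I_i$ on which $T$ reverses orientation; $f$ is the number of flips. The orbit of $p$ is $O(p)=\{T^m(p): m\in\mathbb{Z},\ p\in\mathrm{Dom}(T^m)\}$, and $T$ is transitive if some orbit is dense in $S^1$. *)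

(* Defs.v *)
From Stdlib Require Import Reals Lra Lia List Arith.
Open Scope R_scope.

(* The circle S^1 = [0,1)/(0~1): points are represented by reals in [0,1). *)
Definition circ_pt (x : R) : Prop := 0 <= x < 1.

Definition mod1 (x : R) : R := frac_part x.

Definition cdist (x y : R) : R := Rmin (Rabs (x - y)) (1 - Rabs (x - y)).

Definition cuts_ok (n : nat) (c : nat -> R) : Prop :=
  0 <= c 0%nat /\ (forall i : nat, (S i < n)%nat -> c i < c (S i)) /\ c (n - 1)%nat < 1.

(* The i-th open subinterval I_i (i < n): the open arc from c i to c (i+1),
   the last one (i = n-1) wrapping around 0 back to c 0. *)
Definition in_arc (n : nat) (c : nat -> R) (i : nat) (x : R) : Prop :=
  circ_pt x /\
  (if Nat.ltb (S i) n then c i < x < c (S i)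
   else c (n - 1)%nat < x \/ x < c 0%nat).

Definition in_dom (n : nat) (c : nat -> R) (x : R) : Prop :=
  exists i : nat, (i < n)%nat /\ in_arc n c i x.

Definition extends_cont_at (D : R -> Prop) (T : R -> R) (p : R) : Prop :=
  exists y : R, circ_pt y /\
    forall eps : R, 0 < eps -> exists delta : R, 0 < delta /\
      forall x : R, D x -> cdist x p < delta -> cdist (T x) y < eps.

Definition nflips (n : nat) (fl : nat -> bool) : nat :=
  length (filter fl (seq 0 n)).

(* T is an n-CET with cut points c, whose restriction to I_i is the
   isometry x |-> x + t i (mod 1) if fl i = false (orientation preserving)
   and x |-> t i - x (mod 1) if fl i = true (a flip); T is injective on its
   domain and cannot be continuously extended to any cut point (hence to
   no larger open subset of S^1). *)
Definition is_CET (n : nat) (c t : nat -> R) (fl : nat -> bool) (T : R -> R) : Prop :=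
  (1 <= n)%nat /\ cuts_ok n c /\
  (forall (i : nat) (x : R), (i < n)%nat -> in_arc n c i x ->
      T x = if fl i then mod1 (t i - x) else mod1 (x + t i)) /\
  (forall x y : R, in_dom n c x -> in_dom n c y -> T x = T y -> x = y) /\
  (forall i : nat, (i < n)%nat -> ~ extends_cont_at (in_dom n c) T (c i)).

Fixpoint fwd (D : R -> Prop) (T : R -> R) (m : nat) (x y : R) : Prop :=
  match m with
  | O => x = y
  | S m' => D x /\ fwd D T m' (T x) y
  end.

Definition in_orbit (D : R -> Prop) (T : R -> R) (p q : R) : Prop :=
  exists m : nat, fwd D T m p q \/ fwd D T m q p.

Definition transitive (D : R -> Prop) (T : R -> R) : Prop :=
  exists p : R, circ_pt p /\
    forall (x eps : R), circ_pt x -> 0 < eps ->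
      exists q : R, in_orbit D T p q /\ cdist q x < eps.

(* Main.v *)
Require Import Defs.
From Stdlib Require Import Reals Lra Lia List Arith.
From Stdlib Require Import ZArith Relation_Operators Operators_Properties.
Open Scope R_scope.

(* Few intervals.  If there is exactly one flipped arc A and n <= 3, then either two
   neighbouring arcs are translated alike, or T = sigma o tau where sigma is a
   reflection of the circle and tau is the involution that is the identity on A and
   reflects each other arc in place.  By reversibility, x in A and T^m x in A imply
   T^(2m) x = x, so an orbit that visits A twice is periodic and not dense.  If all of
   at most two arcs are flipped, T is a reflection of the circle.

   Existence.  Four explicit exchanges, with (n, f) = (3, 2), (4, 1), (3, 3), (4, 4),
   have a first return map that is the rotation by sqrt 2 - 1, or is induced by it,
   so they have a dense orbit.  Sending an interval onto a new copy of itself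
   and this copy onto the old image keeps a dense orbit and adds one interval.  With
   a reversed copy, a non-flipped interval becomes two flipped ones, and a flipped
   interval becomes a flipped and a non-flipped one. *)

(** * Interval exchanges with a common cut of domain and image *)

(** The circle is cut open at a point that is a cut of both the domain and the image, and its length
    is left free. A copy of an interval can then be appended at the end while the old points stay in
    place, and rescaling to length 1 happens only once. The obstacle is less density than the demand
    that every cut be a genuine discontinuity: a new interval might continue the branch of its
    neighbour, so the constructions carry inequalities between one-sided limits. Flips are added in
    pairs, together with two intervals; hence one starting exchange for each parity with [n = f],
    and two more for [f = 1] and [f = 2]. The angle sqrt 2 - 1 solves x^2 = 1 - 2 x, so its powers
    are explicit integer combinations of 1 and itself, and density of the rotation becomes a
    computation. *)

Record exch : Type := Exch {
  num : nat; cut : nat -> R; start : nat -> R; flip : nat -> bool }.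

Definition len (E : exch) : R := cut E (num E).

(** [start] is the image of the left end in both cases, so for a flip it is the right end of the
    image and [stop] the left one. *)
Definition img (E : exch) (i : nat) (x : R) : R :=
  if flip E i then start E i - (x - cut E i) else start E i + (x - cut E i).

Definition stop (E : exch) (i : nat) : R := img E i (cut E (S i)).

Definition inner (E : exch) (i : nat) (x : R) : Prop := cut E i < x < cut E (S i).

Definition step (E : exch) (x y : R) : Prop :=
  exists i : nat, (i < num E)%nat /\ inner E i x /\ y = img E i x.

Definition path (E : exch) : R -> R -> Prop := clos_refl_trans R (step E).

(* For [x] and [y] in [0, L]: they differ as points of the circle R/LZ. *)
Definition apart (L x y : R) : Prop :=
  x <> y /\ ~ (x = 0 /\ y = L) /\ ~ (x = L /\ y = 0).

Definition discontinuous (E : exch) : Prop :=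
  (forall i, (S i < num E)%nat -> apart (len E) (stop E i) (start E (S i))) /\
  apart (len E) (stop E (num E - 1)) (start E 0).

(** The ranges of [start] and [stop] prevent an image from wrapping around 0. Each branch is
    injective by itself, so [img_sep] only has to separate different branches. *)
Record valid (E : exch) : Prop := {
  num_pos : (1 <= num E)%nat;
  cut_0 : cut E 0 = 0;
  cut_lt : forall i, (i < num E)%nat -> cut E i < cut E (S i);
  start_range : forall i, (i < num E)%nat -> 0 <= start E i <= len E;
  stop_range : forall i, (i < num E)%nat -> 0 <= stop E i <= len E;
  img_sep : forall i j x y, (i < num E)%nat -> (j < num E)%nat ->
    inner E i x -> inner E j y -> img E i x = img E j y -> i = j;
  disc : discontinuous E }.

(** Density is localised and phrased with subintervals, so that it can be pushed through one branch
    and glued along endpoints. *)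
Definition covers (E : exch) (p lo hi : R) : Prop :=
  forall s e, lo <= s -> s < e -> e <= hi -> exists y, s < y < e /\ path E p y.

Definition dense (E : exch) : Prop :=
  exists p, 0 <= p < len E /\ covers E p 0 (len E).

Lemma cut_mono (E : exch) (i j : nat) :
  valid E -> (i <= j)%nat -> (j <= num E)%nat -> cut E i <= cut E j.
Proof.
  intros V Hij Hj. induction Hij as [|j Hij IH]; [lra|].
  specialize (IH ltac:(lia)). pose proof (cut_lt E V j ltac:(lia)). lra.
Qed.

Lemma cut_range (E : exch) (i : nat) :
  valid E -> (i <= num E)%nat -> 0 <= cut E i <= len E.
Proof.
  intros V Hi. pose proof (cut_mono E 0 i V ltac:(lia) Hi).
  pose proof (cut_mono E i (num E) V Hi ltac:(lia)).
  rewrite (cut_0 E V) in H. unfold len. lra.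
Qed.

Lemma img_range (E : exch) (i : nat) (x : R) :
  valid E -> (i < num E)%nat -> inner E i x -> 0 < img E i x < len E.
Proof.
  intros V Hi Hx. pose proof (start_range E V i Hi). pose proof (stop_range E V i Hi).
  unfold stop, img, inner in *. destruct (flip E i); lra.
Qed.

Lemma covers_img (E : exch) (p : R) (i : nat) (lo hi lo' hi' : R) :
  (i < num E)%nat -> cut E i <= lo -> hi <= cut E (S i) -> covers E p lo hi ->
  (if flip E i then lo' = img E i hi /\ hi' = img E i lo
   else lo' = img E i lo /\ hi' = img E i hi) ->
  covers E p lo' hi'.
Proof.
  intros Hi H1 H2 C Heq s e Hs Hse He. unfold img in Heq.
  destruct (flip E i) eqn:F; destruct Heq as [-> ->].
  - destruct (C (cut E i + (start E i - e)) (cut E i + (start E i - s)))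
      as [y [Hy Py]]; try lra.
    exists (img E i y). unfold img; rewrite F. split; [lra|].
    eapply rt_trans; [exact Py|]. apply rt_step. exists i.
    unfold inner, img; rewrite F. repeat split; (assumption || lra).
  - destruct (C (cut E i + (s - start E i)) (cut E i + (e - start E i)))
      as [y [Hy Py]]; try lra.
    exists (img E i y). unfold img; rewrite F. split; [lra|].
    eapply rt_trans; [exact Py|]. apply rt_step. exists i.
    unfold inner, img; rewrite F. repeat split; (assumption || lra).
Qed.

Lemma covers_union (E : exch) (p a b c : R) :
  covers E p a b -> covers E p b c -> covers E p a c.
Proof.
  intros C1 C2 s e Hs Hse He.
  destruct (Rlt_le_dec s b).
  - destruct (C1 s (Rmin b e)) as [y [Hy P]]; try lra.
    + apply Rmin_glb_lt; lra.
    + apply Rmin_l.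
    + exists y. pose proof (Rmin_r b e). split; [lra|assumption].
  - apply C2; lra.
Qed.

Lemma covers_sub (E : exch) (p a b c d : R) :
  covers E p a b -> a <= c -> d <= b -> covers E p c d.
Proof. intros C H1 H2 s e H3 H4 H5. apply C; lra. Qed.

(** * Towers of height two over an interval *)

Definition upd {A : Type} (f : nat -> A) (k : nat) (v : A) (i : nat) : A :=
  if Nat.eqb i k then v else f i.

Lemma upd_eq {A : Type} (f : nat -> A) (k : nat) (v : A) : upd f k v k = v.
Proof. unfold upd. rewrite Nat.eqb_refl. reflexivity. Qed.

Lemma upd_neq {A : Type} (f : nat -> A) (k i : nat) (v : A) :
  i <> k -> upd f k v i = f i.
Proof. intros H. unfold upd. apply Nat.eqb_neq in H. rewrite H. reflexivity. Qed.

Definition width (E : exch) (j : nat) : R := cut E (S j) - cut E j.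

(* A tower of height two over the interval [j]: a copy of it is appended at the
   end of the circle; the exchange sends interval [j] onto the copy (reversing it
   iff [eps]), and the copy onto the former image of interval [j]. *)
Definition dup (E : exch) (j : nat) (eps : bool) : exch :=
  let L := len E in
  let L' := L + width E j in
  {| num := S (num E);
     cut := upd (cut E) (S (num E)) L';
     start := upd (upd (start E) j (if eps then L' else L)) (num E)
                (if eps then stop E j else start E j);
     flip := upd (upd (flip E) j eps) (num E) (xorb (flip E j) eps) |}.

(** [lift] is the new branch on interval [j], [drop] its inverse; the branch on the copy is
    [img E j] after [drop]. *)
Definition lift (E : exch) (j : nat) (eps : bool) (x : R) : R :=
  if eps then len E + width E j - (x - cut E j) else len E + (x - cut E j).

Definition drop (E : exch) (j : nat) (eps : bool) (x : R) : R :=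
  if eps then cut E j + (len E + width E j - x) else cut E j + (x - len E).

Section Dup.
Context (E : exch) (j : nat) (eps : bool).
Local Notation D := (dup E j eps).

Lemma dup_len : len D = len E + width E j.
Proof. unfold len at 1. simpl. apply upd_eq. Qed.

Lemma dup_cut (i : nat) : (i <= num E)%nat -> cut D i = cut E i.
Proof. intros H. simpl. apply upd_neq. lia. Qed.

Lemma dup_cut_last : cut D (S (num E)) = len E + width E j.
Proof. simpl. apply upd_eq. Qed.

Lemma dup_inner (i : nat) (x : R) : (i < num E)%nat -> inner D i x <-> inner E i x.
Proof. intros H. unfold inner. rewrite !dup_cut by lia. tauto. Qed.

Lemma dup_inner_last (x : R) :
  inner D (num E) x <-> inner E j (drop E j eps x).
Proof.
  unfold inner, drop, width. rewrite dup_cut, dup_cut_last by lia.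
  fold (len E). unfold width. destruct eps; lra.
Qed.

Lemma dup_img (i : nat) (x : R) :
  (i < num E)%nat -> i <> j -> img D i x = img E i x.
Proof.
  intros H Hj. unfold img. rewrite dup_cut by lia. simpl.
  rewrite !(upd_neq _ (num E)) by lia. rewrite !upd_neq by lia. reflexivity.
Qed.

Lemma dup_stop (i : nat) :
  (i < num E)%nat -> i <> j -> stop D i = stop E i.
Proof. intros H Hj. unfold stop. rewrite dup_cut, dup_img by lia. reflexivity. Qed.

Lemma dup_start (i : nat) :
  (i < num E)%nat -> i <> j -> start D i = start E i.
Proof. intros H Hj. simpl. rewrite !upd_neq by lia. reflexivity. Qed.

Lemma dup_img_j (x : R) : (j < num E)%nat -> img D j x = lift E j eps x.
Proof.
  intros H. unfold img, lift. rewrite dup_cut by lia. simpl.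
  rewrite !(upd_neq _ (num E)) by lia. rewrite !upd_eq. destruct eps; reflexivity.
Qed.

Lemma dup_start_j : (j < num E)%nat ->
  start D j = if eps then len E + width E j else len E.
Proof. intros H. simpl. rewrite upd_neq by lia. apply upd_eq. Qed.

Lemma dup_stop_j : (j < num E)%nat ->
  stop D j = if eps then len E else len E + width E j.
Proof.
  intros H. unfold stop. rewrite dup_img_j, dup_cut by lia. unfold lift, width.
  destruct eps; lra.
Qed.

Lemma dup_img_last (x : R) : img D (num E) x = img E j (drop E j eps x).
Proof.
  unfold img. rewrite dup_cut by lia. simpl. rewrite !upd_eq. fold (len E).
  unfold drop, stop, img, width. destruct eps, (flip E j); simpl; lra.
Qed.

Lemma dup_start_last : start D (num E) = if eps then stop E j else start E j.
Proof. simpl. apply upd_eq. Qed.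

Lemma dup_stop_last : stop D (num E) = if eps then start E j else stop E j.
Proof.
  unfold stop. rewrite dup_img_last, dup_cut_last.
  unfold drop, img, width. destruct eps, (flip E j); lra.
Qed.

Lemma lift_range (x : R) :
  inner E j x -> len E < lift E j eps x < len E + width E j.
Proof. unfold inner, lift, width. destruct eps; lra. Qed.

Lemma dup_valid :
  valid E -> (j < num E)%nat -> discontinuous D -> valid D.
Proof.
  intros V Hj HD.
  assert (W : 0 < width E j) by (unfold width; pose proof (cut_lt E V j Hj); lra).
  assert (L0 : 0 <= len E) by (apply (cut_range E (num E) V); lia).
  constructor; [ | | | | | |exact HD].
  - simpl. lia.
  - rewrite dup_cut by lia. apply (cut_0 E V).
  - intros i Hi. simpl in Hi. destruct (Nat.eq_dec i (num E)) as [->|Hn].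
    + rewrite dup_cut_last, dup_cut by lia. fold (len E). lra.
    + rewrite !dup_cut by lia. apply (cut_lt E V). lia.
  - intros i Hi. simpl in Hi. rewrite dup_len.
    pose proof (start_range E V j Hj). pose proof (stop_range E V j Hj).
    destruct (Nat.eq_dec i (num E)) as [->|Hn].
    + rewrite dup_start_last. destruct eps; lra.
    + destruct (Nat.eq_dec i j) as [->|Hn'].
      * rewrite dup_start_j by lia. destruct eps; lra.
      * rewrite dup_start by lia. pose proof (start_range E V i ltac:(lia)). lra.
  - intros i Hi. simpl in Hi. rewrite dup_len.
    pose proof (start_range E V j Hj). pose proof (stop_range E V j Hj).
    destruct (Nat.eq_dec i (num E)) as [->|Hn].
    + rewrite dup_stop_last. destruct eps; lra.
    + destruct (Nat.eq_dec i j) as [->|Hn'].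
      * rewrite dup_stop_j by lia. destruct eps; lra.
      * rewrite dup_stop by lia. pose proof (stop_range E V i ltac:(lia)). lra.
  (* Only branch [j] lands above [len E]. Every other branch has the image of an old one, the last
     branch inheriting that of [j], so the separation of images reduces to that for [E]. *)
  - assert (K : forall i x, (i < S (num E))%nat -> inner D i x ->
      (i = j /\ len E < img D i x) \/
      (i <> j /\ exists i0 x0, (i0 < num E)%nat /\ inner E i0 x0 /\
         img D i x = img E i0 x0 /\ (i = i0 \/ (i = num E /\ i0 = j)))).
    { intros i x Hi Hx. destruct (Nat.eq_dec i (num E)) as [->|Hn].
      - right. split; [lia|]. exists j, (drop E j eps x).
        rewrite <- dup_inner_last, dup_img_last. tauto.
      - destruct (Nat.eq_dec i j) as [->|Hn'].
        + left. split; [reflexivity|]. rewrite dup_img_j by lia.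
          apply lift_range. apply dup_inner; assumption.
        + right. split; [assumption|]. exists i, x.
          rewrite dup_img by lia. apply dup_inner in Hx; [|lia].
          repeat split; try apply Hx; auto. lia. }
    intros i k x y Hi Hk Hx Hy Heq. simpl in Hi, Hk.
    destruct (K i x Hi Hx) as [[-> H1]|[N1 (i0 & x0 & Hi0 & Hx0 & E1 & O1)]];
    destruct (K k y Hk Hy) as [[-> H2]|[N2 (k0 & y0 & Hk0 & Hy0 & E2 & O2)]].
    + reflexivity.
    + exfalso. pose proof (img_range E k0 y0 V Hk0 Hy0). lra.
    + exfalso. pose proof (img_range E i0 x0 V Hi0 Hx0). lra.
    + assert (i0 = k0) by (apply (img_sep E V i0 k0 x0 y0); auto; congruence). lia.
Qed.

(** A step through interval [j] becomes two steps, up to the copy and back; all other steps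
    persist. *)
Lemma dup_path (x y : R) : (j < num E)%nat -> path E x y -> path D x y.
Proof.
  intros Hj P. induction P as [x y S|x|x y z _ IH1 _ IH2].
  - destruct S as (i & Hi & Hx & ->). destruct (Nat.eq_dec i j) as [->|Hn].
    + eapply rt_trans; apply rt_step.
      * exists j. split; [simpl; lia|]. split; [|reflexivity].
        apply dup_inner; assumption.
      * assert (drop E j eps (img D j x) = x) as Hd
          by (rewrite dup_img_j by lia; unfold drop, lift; destruct eps; lra).
        exists (num E). split; [simpl; lia|].
        rewrite dup_inner_last, dup_img_last, Hd. auto.
    + apply rt_step. exists i. split; [simpl; lia|].
      rewrite dup_img by lia. split; [|reflexivity]. apply dup_inner; assumption.
  - apply rt_refl.
  - eapply rt_trans; eassumption.
Qed.

Lemma dup_dense : valid E -> (j < num E)%nat -> dense E -> dense D.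
Proof.
  intros V Hj (p & Hp & C).
  pose proof (cut_lt E V j Hj) as W.
  assert (C' : covers D p 0 (len E)).
  { intros s e H1 H2 H3. destruct (C s e H1 H2 H3) as [y [Hy P]].
    exists y. split; [assumption|]. apply dup_path; assumption. }
  exists p. rewrite dup_len. split; [unfold width; lra|].
  apply covers_union with (len E); [exact C'|].
  (* The copy is the image of interval [j], over which density is already known. *)
  apply (covers_img D p j (cut E j) (cut E (S j))).
  - simpl; lia.
  - rewrite dup_cut by lia. lra.
  - rewrite dup_cut by lia. lra.
  - pose proof (cut_range E j V ltac:(lia)).
    pose proof (cut_range E (S j) V ltac:(lia)).
    intros s e H1 H2 H3. apply C'; lra.
  - rewrite !dup_img_j by lia. simpl. rewrite upd_neq, upd_eq by lia.
    unfold lift, width. destruct eps; lra.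
Qed.

End Dup.

(** * Adding intervals and flips *)

Lemma nflips_S (n : nat) (fl : nat -> bool) :
  nflips (S n) fl = (nflips n fl + Nat.b2n (fl n))%nat.
Proof.
  unfold nflips. rewrite seq_S, filter_app, length_app. simpl.
  destruct (fl n); reflexivity.
Qed.

Lemma nflips_ext (n : nat) (f g : nat -> bool) :
  (forall i, (i < n)%nat -> f i = g i) -> nflips n f = nflips n g.
Proof.
  intros H. induction n as [|n IH]; [reflexivity|].
  rewrite !nflips_S, (H n), IH by (intros; try apply H; lia). reflexivity.
Qed.

Lemma nflips_upd (n j : nat) (fl : nat -> bool) (b : bool) :
  (j < n)%nat ->
  (nflips n (upd fl j b) + Nat.b2n (fl j) = nflips n fl + Nat.b2n b)%nat.
Proof.
  intros H. induction n as [|n IH]; [lia|]. rewrite !nflips_S.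
  destruct (Nat.eq_dec j n) as [->|Hn].
  - rewrite upd_eq, (nflips_ext n (upd fl n b) fl)
      by (intros; apply upd_neq; lia). lia.
  - rewrite (upd_neq _ j n) by lia. specialize (IH ltac:(lia)). lia.
Qed.

Lemma dup_flips (E : exch) (j : nat) (eps : bool) :
  (j < num E)%nat ->
  (nflips (num (dup E j eps)) (flip (dup E j eps)) + Nat.b2n (flip E j) =
   nflips (num E) (flip E) + Nat.b2n eps + Nat.b2n (xorb (flip E j) eps))%nat.
Proof.
  intros H. simpl num. rewrite nflips_S. simpl flip. rewrite upd_eq.
  rewrite (nflips_ext _ _ (upd (flip E) j eps)) by (intros; apply upd_neq; lia).
  pose proof (nflips_upd (num E) j (flip E) eps H). lia.
Qed.

Lemma dup_flip_last (E : exch) (j : nat) (eps : bool) :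
  flip (dup E j eps) (num E) = xorb (flip E j) eps.
Proof. apply upd_eq. Qed.

Definition good (n f : nat) (E : exch) : Prop :=
  valid E /\ dense E /\ num E = n /\ nflips n (flip E) = f.

(* Translated copies of the same interval appended one after another would leave
   removable cuts between them; duplicating the last and the second last interval
   in turn avoids this, and [state_last], [state_prev] record whose turn it is. *)
Definition state_last (E : exch) : Prop :=
  (3 <= num E)%nat /\
  stop E (num E - 2) <> len E /\ start E (num E - 1) <> 0 /\
  stop E (num E - 1) <> len E.

Definition state_prev (E : exch) : Prop :=
  (4 <= num E)%nat /\
  stop E (num E - 3) <> len E /\ start E (num E - 1) <> 0 /\
  stop E (num E - 1) <> start E (num E - 2) /\
  stop E (num E - 2) <> start E 0 /\ start E (num E - 2) <> 0.

(** The two extra inequalities serve reversed copies: the last interval is then sent to the top end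
    of the longer circle, which is the point 0, and its copy ends at the old [start], next to
    [start E 0]. *)
Definition state_flip (E : exch) : Prop :=
  state_last E /\ flip E (num E - 1) = true /\
  stop E (num E - 2) <> 0 /\ start E (num E - 1) <> start E 0.

Lemma dup_good (n f : nat) (E : exch) (j : nat) (eps : bool) (f' : nat) :
  good n f E -> (j < n)%nat -> discontinuous (dup E j eps) ->
  (f' + Nat.b2n (flip E j) = f + Nat.b2n eps + Nat.b2n (xorb (flip E j) eps))%nat ->
  good (S n) f' (dup E j eps).
Proof.
  intros (V & C & Hn & Hf) Hj HD Heq. subst n.
  split; [apply dup_valid; assumption|].
  split; [apply dup_dense; assumption|].
  split; [reflexivity|].
  pose proof (dup_flips E j eps Hj) as K. simpl num in K. lia.
Qed.

(* The new cuts at which [dup] could create a removable discontinuity are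
   the two ends of interval [j], the end of the old circle and the end of the new one. *)
Lemma dup_discontinuous (E : exch) (j : nat) (eps : bool) :
  valid E -> (1 <= j < num E)%nat ->
  apart (len E + width E j) (stop E (j - 1)) (start (dup E j eps) j) ->
  ((S j < num E)%nat ->
     apart (len E + width E j) (stop (dup E j eps) j) (start E (S j)) /\
     apart (len E + width E j) (stop E (num E - 1)) (start (dup E j eps) (num E))) ->
  (S j = num E ->
     apart (len E + width E j) (stop (dup E j eps) j) (start (dup E j eps) (num E))) ->
  apart (len E + width E j) (stop (dup E j eps) (num E)) (start E 0) ->
  discontinuous (dup E j eps).
Proof.
  intros V Hj H1 H2 H3 H4.
  assert (W : 0 < width E j) by (unfold width; pose proof (cut_lt E V j ltac:(lia)); lra).
  split.
  - intros i Hi. rewrite dup_len. simpl num in Hi.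
    destruct (Nat.eq_dec (S i) (num E)) as [Hl|Hl].
    + rewrite Hl. destruct (Nat.eq_dec i j) as [->|Hij].
      * auto.
      * rewrite dup_stop by lia. replace i with (num E - 1)%nat by lia.
        apply H2. lia.
    + destruct (Nat.eq_dec i j) as [->|Hij].
      * rewrite (dup_start E j eps (S j)) by lia. apply H2. lia.
      * rewrite dup_stop by lia. destruct (Nat.eq_dec (S i) j) as [Hs|Hs].
        -- rewrite Hs. replace i with (j - 1)%nat by lia. exact H1.
        -- rewrite dup_start by lia.
           destruct (proj1 (disc E V) i ltac:(lia)) as [K _].
           pose proof (start_range E V (S i) ltac:(lia)).
           pose proof (stop_range E V i ltac:(lia)).
           unfold apart. lra.
  - rewrite dup_len. replace (num (dup E j eps) - 1)%nat with (num E) by (simpl; lia).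
    rewrite (dup_start E j eps 0) by lia. exact H4.
Qed.

Ltac dup_values :=
  repeat first
    [ rewrite dup_start_last | rewrite dup_stop_last
    | rewrite dup_start_j by lia | rewrite dup_stop_j by lia
    | rewrite dup_start by lia | rewrite dup_stop by lia
    | rewrite dup_len ].

Lemma state_last_dup (n f : nat) (E : exch) :
  good n f E -> state_last E ->
  let E' := dup E (num E - 1) false in good (S n) f E' /\ state_prev E'.
Proof.
  intros G (H3 & S1 & S2 & S3) E'. pose proof G as (V & _ & Hn & _).
  set (m := num E) in *.
  assert (W : 0 < width E (m - 1))
    by (unfold width; pose proof (cut_lt E V (m - 1) ltac:(lia)); lra).
  pose proof (start_range E V 0 ltac:(lia)).
  pose proof (start_range E V (m - 1) ltac:(lia)).
  pose proof (stop_range E V (m - 1) ltac:(lia)).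
  pose proof (stop_range E V (m - 2) ltac:(lia)).
  pose proof (proj2 (disc E V)) as [K _]. fold m in K.
  split.
  - apply (dup_good n f); [assumption|lia| |destruct (flip E (m - 1)); simpl; lia].
    apply dup_discontinuous; [assumption|lia|..]; fold m; dup_values.
    + replace (m - 1 - 1)%nat with (m - 2)%nat by lia. unfold apart. lra.
    + lia.
    + intros _. unfold apart. lra.
    + unfold apart. lra.
  - unfold state_prev. replace (num E') with (S m) by reflexivity. unfold E'.
    replace (S m - 3)%nat with (m - 2)%nat by lia.
    replace (S m - 2)%nat with (m - 1)%nat by lia.
    replace (S m - 1)%nat with m by lia.
    unfold m; dup_values; fold m. repeat split; lia || lra.
Qed.

Lemma state_prev_dup (n f : nat) (E : exch) :
  good n f E -> state_prev E ->
  let E' := dup E (num E - 2) false in good (S n) f E' /\ state_last E'.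
Proof.
  intros G (H3 & S1 & S2 & S3 & S4 & S5) E'. pose proof G as (V & _ & Hn & _).
  set (m := num E) in *.
  assert (W : 0 < width E (m - 2))
    by (unfold width; pose proof (cut_lt E V (m - 2) ltac:(lia)); lra).
  pose proof (start_range E V 0 ltac:(lia)).
  pose proof (start_range E V (m - 1) ltac:(lia)).
  pose proof (start_range E V (m - 2) ltac:(lia)).
  pose proof (stop_range E V (m - 1) ltac:(lia)).
  pose proof (stop_range E V (m - 2) ltac:(lia)).
  pose proof (stop_range E V (m - 3) ltac:(lia)).
  split.
  - apply (dup_good n f); [assumption|lia| |destruct (flip E (m - 2)); simpl; lia].
    apply dup_discontinuous; [assumption|lia|..]; fold m; dup_values.
    + replace (m - 2 - 1)%nat with (m - 3)%nat by lia. unfold apart. lra.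
    + intros _. replace (S (m - 2)) with (m - 1)%nat by lia.
      split; unfold apart; lra.
    + lia.
    + unfold apart. lra.
  - unfold state_last. replace (num E') with (S m) by reflexivity. unfold E'.
    replace (S m - 2)%nat with (m - 1)%nat by lia.
    replace (S m - 1)%nat with m by lia.
    unfold m; dup_values; fold m. repeat split; lia || lra.
Qed.

Lemma more_intervals (n f : nat) (E : exch) (k : nat) :
  good n f E -> state_last E ->
  exists E', good (n + k) f E'.
Proof.
  intros G S.
  (* The two states alternate with [k], so the induction carries their disjunction. *)
  assert (H : (exists E', good (n + k) f E' /\ state_last E') \/
              (exists E', good (n + k) f E' /\ state_prev E')).
  { induction k as [|k [[E' [G' S']]|[E' [G' S']]]].
    - left. exists E. rewrite Nat.add_0_r. auto.
    - right. rewrite Nat.add_succ_r. eexists. apply (state_last_dup _ _ E' G' S').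
    - left. rewrite Nat.add_succ_r. eexists. apply (state_prev_dup _ _ E' G' S'). }
  destruct H as [[E' [G' _]]|[E' [G' _]]]; eauto.
Qed.

(** A reversed copy of the flipped last interval leaves a non-flipped interval at the end and the
    number of flips unchanged; a reversed copy of that one creates two flips and puts a flip last
    again. *)
Lemma state_flip_dup2 (n f : nat) (E : exch) :
  good n f E -> state_flip E ->
  exists E', good (S (S n)) (S (S f)) E' /\ state_flip E'.
Proof.
  intros G ((H3 & S1 & S2 & S3) & F & S4 & S5). pose proof G as (V & _ & Hn & _).
  set (m := num E) in *.
  assert (W : 0 < width E (m - 1))
    by (unfold width; pose proof (cut_lt E V (m - 1) ltac:(lia)); lra).
  pose proof (start_range E V 0 ltac:(lia)).
  pose proof (start_range E V (m - 1) ltac:(lia)).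
  pose proof (stop_range E V (m - 1) ltac:(lia)).
  pose proof (stop_range E V (m - 2) ltac:(lia)).
  pose proof (proj2 (disc E V)) as [K _]. fold m in K.
  assert (G1 : good (S n) f (dup E (m - 1) true)).
  { apply (dup_good n f); [assumption|lia| |rewrite F; simpl; lia].
    apply dup_discontinuous; [assumption|lia|..]; fold m; dup_values.
    - replace (m - 1 - 1)%nat with (m - 2)%nat by lia. unfold apart. lra.
    - lia.
    - intros _. unfold apart. lra.
    - unfold apart. lra. }
  set (E1 := dup E (m - 1) true) in *.
  assert (V1 : valid E1) by apply G1.
  assert (N1 : num E1 = S m) by reflexivity.
  assert (F1 : flip E1 m = false).
  { unfold E1. unfold m at 2. rewrite dup_flip_last, F. reflexivity. }
  assert (A0 : start E1 0 = start E 0) by (apply dup_start; fold m; lia).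
  assert (Am : start E1 m = stop E (m - 1)) by apply dup_start_last.
  assert (Rm : stop E1 m = start E (m - 1)) by apply dup_stop_last.
  assert (Rp : stop E1 (m - 1) = len E) by (apply dup_stop_j; fold m; lia).
  assert (L1 : len E1 = len E + width E (m - 1)) by apply dup_len.
  assert (W1 : 0 < width E1 m) by (unfold width; pose proof (cut_lt E1 V1 m ltac:(lia)); lra).
  exists (dup E1 m true).
  assert (J : (m < num E1)%nat) by lia.
  split; [|unfold state_flip, state_last].
  - apply (dup_good (S n) f); [assumption|lia| |rewrite F1; simpl; lia].
    apply dup_discontinuous; [assumption|lia|..]; dup_values.
    + rewrite Rp, L1. unfold apart. lra.
    + lia.
    + intros _. rewrite Rm, L1. unfold apart. lra.
    + rewrite A0, Am, L1. unfold apart. lra.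
  - replace (num (dup E1 m true)) with (S (S m)) by reflexivity.
    replace (S (S m) - 2)%nat with m by lia.
    replace (S (S m) - 1)%nat with (num E1) by lia.
    dup_values.
    rewrite dup_flip_last, F1, A0, Am, Rm, L1. repeat split; lia || lra.
Qed.

Lemma more_flips (n f : nat) (E : exch) (k : nat) :
  good n f E -> state_flip E ->
  exists E', good (n + 2 * k) (f + 2 * k) E' /\ state_flip E'.
Proof.
  intros G S. induction k as [|k (E' & G' & S')].
  - exists E. rewrite !Nat.add_0_r. auto.
  - destruct (state_flip_dup2 _ _ E' G' S') as (E'' & G'' & S'').
    exists E''. split; [|assumption].
    replace (n + 2 * Datatypes.S k)%nat with (Datatypes.S (Datatypes.S (n + 2 * k))) by lia.
    replace (f + 2 * Datatypes.S k)%nat with (Datatypes.S (Datatypes.S (f + 2 * k))) by lia.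
    assumption.
Qed.

(** * A rotation and four exchanges built on it *)

Definition angle : R := sqrt 2 - 1.

Lemma angle_sq : angle * angle = 1 - 2 * angle.
Proof. unfold angle. pose proof (sqrt_sqrt 2 ltac:(lra)). lra. Qed.

Lemma angle_range : 2 / 5 < angle < 1 / 2.
Proof.
  unfold angle. pose proof (sqrt_sqrt 2 ltac:(lra)). pose proof (sqrt_pos 2).
  split; nra.
Qed.

(** In the coordinate of [rot], the cuts met while following an orbit lie in Z + Z [angle], so a
    generic point avoids them forever. *)
Definition generic (x : R) : Prop :=
  0 < x < 1 /\ forall a b : Z, x <> IZR a + IZR b * angle.

Definition rot (x : R) : R := if Rlt_dec x (1 - angle) then x + angle else x + angle - 1.

(* If 1/3 = a + b angle then (1 - 3 a + 3 b)^2 = 18 b^2, which fails modulo 3. *)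
Lemma generic_third : generic (1 / 3).
Proof.
  split; [lra|]. intros a b H.
  assert (K : (1 - 3 * IZR a + 3 * IZR b) * (1 - 3 * IZR a + 3 * IZR b)
              = 18 * (IZR b * IZR b)).
  { assert (1 - 3 * IZR a + 3 * IZR b = 3 * IZR b * sqrt 2) as ->
      by (unfold angle in H; lra).
    transitivity (9 * (IZR b * IZR b) * (sqrt 2 * sqrt 2)); [ring|].
    rewrite sqrt_sqrt by lra. ring. }
  assert (K' : ((1 - 3 * a + 3 * b) * (1 - 3 * a + 3 * b) = 18 * (b * b))%Z).
  { apply eq_IZR. rewrite !mult_IZR, plus_IZR, minus_IZR, !mult_IZR. exact K. }
  lia.
Qed.

Lemma generic_rot (x : R) : generic x -> generic (rot x).
Proof.
  intros [Hx G]. pose proof angle_range. unfold rot.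
  pose proof (G 1%Z (-1)%Z) as G1. simpl in G1.
  destruct (Rlt_dec x (1 - angle)) as [l|l]; (split; [lra|]); intros a b E.
  - apply (G a (b - 1)%Z). rewrite minus_IZR. lra.
  - apply (G (a + 1)%Z (b - 1)%Z). rewrite minus_IZR, plus_IZR. lra.
Qed.

(** Multiplication by [angle]^2 = 1 - 2 [angle] turns (a, b) into (2 b + a, 5 b + 2 a). Odd powers
    keep both coefficients natural in this form; for even powers the signs are opposite. *)
Lemma angle_odd_power (k : nat) :
  exists a b : nat, angle * (angle * angle) ^ k = INR b * angle - INR a.
Proof.
  induction k as [|k (a & b & IH)].
  - exists 0%nat, 1%nat. simpl. lra.
  - exists (2 * b + a)%nat, (5 * b + 2 * a)%nat.
    replace (angle * (angle * angle) ^ S k) with (angle * (angle * angle) ^ k * (angle * angle))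
      by (simpl; ring).
    rewrite IH, !plus_INR, !mult_INR. simpl (INR 2). simpl (INR 5).
    replace ((INR b * angle - INR a) * (angle * angle)) with
      (INR b * angle * (1 - 2 * angle) - INR a * (1 - 2 * angle)) by (rewrite angle_sq; ring).
    replace (INR b * angle * (1 - 2 * angle)) with (INR b * (angle - 2 * (angle * angle))) by ring.
    rewrite angle_sq. ring.
Qed.

Lemma angle_small (d : R) : 0 < d ->
  exists a b : nat, 0 < INR b * angle - INR a < d.
Proof.
  intros Hd. pose proof angle_range.
  assert (Hsq : 0 < angle * angle < 1) by nra.
  destruct (pow_lt_1_zero (angle * angle) ltac:(rewrite Rabs_right; lra) d Hd) as [k Hk].
  specialize (Hk k (Nat.le_refl k)).
  destruct (angle_odd_power k) as (a & b & E). exists a, b. rewrite <- E.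
  pose proof (pow_lt (angle * angle) k ltac:(lra)).
  rewrite Rabs_right in Hk by lra. split; nra.
Qed.

Lemma rot_iter (n : nat) :
  generic (Nat.iter n rot (1 / 3)) /\
  exists m : Z, Nat.iter n rot (1 / 3) = 1 / 3 + INR n * angle - IZR m.
Proof.
  induction n as [|n [G (m & E)]].
  - split; [exact generic_third|]. exists 0%Z. simpl. lra.
  - split; [apply generic_rot; exact G|]. rewrite S_INR.
    change (Nat.iter (S n) rot (1 / 3)) with (rot (Nat.iter n rot (1 / 3))).
    unfold rot at 1. destruct (Rlt_dec _ _).
    + exists m. lra.
    + exists (m + 1)%Z. rewrite plus_IZR. lra.
Qed.

Lemma rot_dense (lo hi : R) : 0 <= lo -> lo < hi -> hi <= 1 ->
  exists n : nat, lo < Nat.iter n rot (1 / 3) < hi.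
Proof.
  intros H0 H1 H2.
  destruct (angle_small (hi - lo) ltac:(lra)) as (a & b & Hd).
  set (d := INR b * angle - INR a) in *.
  (* Steps of size [d], each worth [b] rotations, lead from 1/3 into the target shifted by 1. The
     shift makes [q] positive even when [lo] is below 1/3. *)
  set (q := (lo + 1 - 1 / 3) / d).
  assert (Hq : q * d = lo + 1 - 1 / 3) by (unfold q; field; lra).
  assert (q0 : 0 < q) by nra.
  destruct (archimed q) as [A1 A2].
  assert (Hz : (0 <= up q)%Z) by (apply le_IZR; lra).
  set (j := Z.to_nat (up q)).
  assert (Hj : INR j = IZR (up q)) by (unfold j; rewrite INR_IZR_INZ, Z2Nat.id; auto).
  assert (Hlo : lo < 1 / 3 + INR j * d - 1) by (rewrite Hj; nra).
  assert (Hhi : 1 / 3 + INR j * d - 1 < hi) by (rewrite Hj; nra).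
  exists (j * b)%nat.
  destruct (rot_iter (j * b)) as [[G _] (m & E)].
  rewrite mult_INR in E.
  assert (E' : Nat.iter (j * b) rot (1 / 3) =
      1 / 3 + INR j * d - 1 + IZR (Z.of_nat (j * a) + 1 - m)).
  { rewrite minus_IZR, plus_IZR, <- INR_IZR_INZ, mult_INR, E. unfold d. ring. }
  (* Both points lie in (0, 1) and differ by the integer [r], which must vanish. *)
  set (r := (Z.of_nat (j * a) + 1 - m)%Z) in *.
  assert (R0 : r = 0%Z).
  { assert (-1 < r)%Z by (apply lt_IZR; lra).
    assert (r < 1)%Z by (apply lt_IZR; lra). lia. }
  rewrite R0 in E'. lra.
Qed.

(** [h] has to be a translation only on (0, [hi]), which leaves room for exchanges that realise an
    induced map of [rot]. *)
Lemma rot_covers (E : exch) (h : R -> R) (s hi : R) :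
  (forall x, generic x -> path E (h x) (h (rot x))) ->
  (forall x, 0 < x < hi -> h x = x + s) -> hi <= 1 ->
  covers E (h (1 / 3)) s (hi + s).
Proof.
  intros H Hh H1 lo up H2 H3 H4.
  destruct (rot_dense (lo - s) (up - s)) as [n Hn]; try lra.
  exists (h (Nat.iter n rot (1 / 3))). split; [rewrite Hh; lra|].
  clear Hn. induction n as [|n IH]; [apply rt_refl|].
  eapply rt_trans; [exact IH|]. apply H. apply rot_iter.
Qed.

(* First returns to a suitable interval give back [rot]: on [0, 1] for the
   exchanges with 3 intervals, on [2 b, 1 + 2 b] for [exch_4_1]; the return map
   of [exch_4_4] to [0, 2 angle] is the map induced by [rot]. *)
Definition of_list {A : Type} (d : A) (l : list A) (i : nat) : A := nth i l d.

Definition mk (cs ss : list R) (fs : list bool) : exch :=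
  Exch (length fs) (of_list 0 cs) (of_list 0 ss) (of_list false fs).

(** This is [rot] with a reversed tower over [1 - angle, 1]: the two reflections compose to the
    translation by angle - 1. *)
Definition exch_3_2 : exch :=
  mk (0 :: 1 - angle :: 1 :: 1 + angle :: nil) (angle :: 1 + angle :: angle :: nil)
     (false :: true :: true :: nil).

(** Both branches of [rot] are followed by a reflection onto a second floor [1, 2], which a single
    reflection brings back. *)
Definition exch_3_3 : exch :=
  mk (0 :: 1 - angle :: 1 :: 2 :: nil) (2 - angle :: 2 :: 1 :: nil)
     (true :: true :: true :: nil).

(** A point that leaves the base [2 b, 1 + 2 b] crosses the only flip [0, 2 b] twice, once in each
    half, so it returns with its orientation restored. *)
Definition exch_4_1 : exch :=
  let b := 1 - angle in
  mk (0 :: 2 * b :: 3 * b :: 1 + 2 * b :: 1 + 3 * b :: nil)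
     (1 + 3 * b :: 0 :: 2 * b :: b :: nil)
     (true :: false :: false :: false :: nil).

(** The two floors of [exch_3_3], now over the map induced by [rot] on [0, 2 angle], which has three
    branches. *)
Definition exch_4_4 : exch :=
  mk (0 :: angle :: 1 - angle :: 2 * angle :: 4 * angle :: nil)
     (3 * angle :: 1 + angle :: 4 * angle :: 2 * angle :: nil)
     (true :: true :: true :: true :: nil).

Ltac index i H := simpl in H; repeat (destruct i as [|i]; [|try lia]).

Ltac unfold_exch := unfold discontinuous, apart, stop, len, inner, img in *; simpl in *;
  unfold of_list in *; simpl in *.

Ltac solve_valid := pose proof angle_range; constructor;
  [ simpl; lia | reflexivity
  | intros i H'; index i H'; unfold_exch; lra
  | intros i H'; index i H'; unfold_exch; lra
  | intros i H'; index i H'; unfold_exch; lra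
  | intros i j x y H1 H2; index i H1; index j H2; unfold_exch; intros; try lia; exfalso; lra
  | split; [intros i H'; index i H'; unfold_exch; lra | unfold_exch; lra] ].

Lemma exch_3_2_valid : valid exch_3_2.
Proof. solve_valid. Qed.
Lemma exch_3_3_valid : valid exch_3_3.
Proof. solve_valid. Qed.
Lemma exch_4_1_valid : valid exch_4_1.
Proof. solve_valid. Qed.
Lemma exch_4_4_valid : valid exch_4_4.
Proof. solve_valid. Qed.

Ltac follow i := eapply rt_trans;
  [apply rt_step; exists i; split; [simpl; lia|split; [unfold_exch; lra|reflexivity]]|].
Ltac arrive :=
  unfold path; match goal with |- clos_refl_trans _ _ ?x ?y =>
    replace y with x; [apply rt_refl|unfold_exch; lra] end.
Ltac image i lo hi := apply (covers_img _ _ i lo hi);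
  [simpl; lia|unfold_exch; lra|unfold_exch; lra| |unfold_exch; lra].

Lemma exch_3_2_dense : dense exch_3_2.
Proof.
  pose proof angle_range.
  assert (C : covers exch_3_2 (1 / 3) 0 (1 + 0)).
  { apply (rot_covers exch_3_2 (fun x => x)); [|intros; lra|lra].
    intros x [Hx G]. specialize (G 1%Z (-1)%Z). unfold rot.
    destruct (Rlt_dec x (1 - angle)).
    - follow 0%nat. arrive.
    - follow 1%nat. follow 2%nat. arrive. }
  exists (1 / 3). split; [unfold_exch; lra|].
  apply covers_union with 1; [apply (covers_sub _ _ _ _ _ _ C); lra|].
  image 1%nat (1 - angle) 1. apply (covers_sub _ _ _ _ _ _ C); lra.
Qed.

Lemma exch_3_3_dense : dense exch_3_3.
Proof.
  pose proof angle_range.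
  assert (C : covers exch_3_3 (1 / 3) 0 (1 + 0)).
  { apply (rot_covers exch_3_3 (fun x => x)); [|intros; lra|lra].
    intros x [Hx G]. specialize (G 1%Z (-1)%Z). unfold rot.
    destruct (Rlt_dec x (1 - angle)).
    - follow 0%nat. follow 2%nat. arrive.
    - follow 1%nat. follow 2%nat. arrive. }
  exists (1 / 3). split; [unfold_exch; lra|].
  apply covers_union with 1; [apply (covers_sub _ _ _ _ _ _ C); lra|].
  apply covers_union with (2 - angle).
  - image 0%nat 0 (1 - angle). apply (covers_sub _ _ _ _ _ _ C); lra.
  - image 1%nat (1 - angle) 1. apply (covers_sub _ _ _ _ _ _ C); lra.
Qed.

Lemma exch_4_1_dense : dense exch_4_1.
Proof.
  pose proof angle_range. set (p := 1 / 3 + 2 * (1 - angle)).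
  assert (C : covers exch_4_1 p (2 * (1 - angle)) (1 + 2 * (1 - angle))).
  { apply (rot_covers exch_4_1 (fun x => x + 2 * (1 - angle))); [|intros; lra|lra].
    intros x [Hx G]. specialize (G 1%Z (-1)%Z). unfold rot.
    destruct (Rlt_dec x (1 - angle)).
    - follow 1%nat. follow 0%nat. follow 3%nat. follow 0%nat. arrive.
    - follow 2%nat. arrive. }
  assert (C1 : covers exch_4_1 p 0 (1 - angle)).
  { image 1%nat (2 * (1 - angle)) (3 * (1 - angle)). apply (covers_sub _ _ _ _ _ _ C); lra. }
  assert (C3 : covers exch_4_1 p (1 + 2 * (1 - angle)) (1 + 3 * (1 - angle))).
  { image 0%nat 0 (1 - angle). exact C1. }
  exists p. split; [unfold p; unfold_exch; lra|].
  apply covers_union with (1 - angle); [exact C1|].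
  apply covers_union with (2 * (1 - angle)).
  - image 3%nat (1 + 2 * (1 - angle)) (1 + 3 * (1 - angle)). exact C3.
  - apply covers_union with (1 + 2 * (1 - angle)); [exact C|].
    apply (covers_sub _ _ _ _ _ _ C3); unfold_exch; lra.
Qed.

Lemma exch_4_4_dense : dense exch_4_4.
Proof.
  pose proof angle_range.
  (* A point outside the base [0, 2 angle) is represented by its preimage under [rot], which lies in
     [angle, 1 - angle); there one step of the induced map stands for two rotations. *)
  set (h := fun x => if Rlt_dec x (2 * angle) then x else x - angle).
  assert (h1 : forall x, x < 2 * angle -> h x = x)
    by (intros x Hx; unfold h; destruct (Rlt_dec x (2 * angle)); lra).
  assert (h2 : forall x, 2 * angle <= x -> h x = x - angle)
    by (intros x Hx; unfold h; destruct (Rlt_dec x (2 * angle)); lra).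
  assert (C : covers exch_4_4 (h (1 / 3)) 0 (2 * angle + 0)).
  { apply rot_covers; [|intros; rewrite h1; lra|lra].
    intros x [Hx G]. pose proof (G 1%Z (-1)%Z). pose proof (G 0%Z 1%Z).
    pose proof (G 0%Z 2%Z). unfold rot.
    destruct (Rlt_dec x (1 - angle)).
    - rewrite (h1 x) by lra. destruct (Rlt_dec x angle).
      + rewrite h1 by lra. follow 0%nat. follow 3%nat. arrive.
      + rewrite h2 by lra. arrive.
    - rewrite (h1 (x + angle - 1)) by lra. destruct (Rlt_dec x (2 * angle)).
      + rewrite h1 by lra. follow 2%nat. follow 3%nat. arrive.
      + rewrite h2 by lra. follow 1%nat. follow 3%nat. arrive. }
  exists (h (1 / 3)). split; [rewrite h1 by lra; unfold_exch; lra|].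
  apply covers_union with (2 * angle); [apply (covers_sub _ _ _ _ _ _ C); lra|].
  apply covers_union with (3 * angle).
  { image 0%nat 0 angle. apply (covers_sub _ _ _ _ _ _ C); lra. }
  apply covers_union with (1 + angle).
  { image 1%nat angle (1 - angle). apply (covers_sub _ _ _ _ _ _ C); lra. }
  image 2%nat (1 - angle) (2 * angle). apply (covers_sub _ _ _ _ _ _ C); lra.
Qed.

Lemma exists_good (n f : nat) :
  (1 <= f)%nat -> (f <= n)%nat -> (5 <= n + f)%nat -> exists E, good n f E.
Proof.
  intros Hf Hn H5. pose proof angle_range.
  assert (G41 : good 4 1 exch_4_1).
  { exact (conj exch_4_1_valid (conj exch_4_1_dense (conj eq_refl eq_refl))). }
  assert (S41 : state_last exch_4_1).
  { unfold state_flip, state_last. unfold_exch. repeat split; lia || lra. }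
  assert (G32 : good 3 2 exch_3_2).
  { exact (conj exch_3_2_valid (conj exch_3_2_dense (conj eq_refl eq_refl))). }
  assert (S32 : state_last exch_3_2).
  { unfold state_flip, state_last. unfold_exch. repeat split; lia || lra. }
  assert (G33 : good 3 3 exch_3_3).
  { exact (conj exch_3_3_valid (conj exch_3_3_dense (conj eq_refl eq_refl))). }
  assert (S33 : state_flip exch_3_3).
  { unfold state_flip, state_last. unfold_exch. repeat split; lia || lra. }
  assert (G44 : good 4 4 exch_4_4).
  { exact (conj exch_4_4_valid (conj exch_4_4_dense (conj eq_refl eq_refl))). }
  assert (S44 : state_flip exch_4_4).
  { unfold state_flip, state_last. unfold_exch. repeat split; lia || lra. }
  destruct (Nat.eq_dec f 1) as [->|]; [|destruct (Nat.eq_dec f 2) as [->|]].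
  - replace n with (4 + (n - 4))%nat by lia. eapply more_intervals; eassumption.
  - replace n with (3 + (n - 3))%nat by lia. eapply more_intervals; eassumption.
  (* The case [n = f] comes first, since adding flips preserves [n - f]; only then are intervals
     added. *)
  - assert (K : exists E, good f f E /\ state_flip E).
    { destruct (Nat.Even_or_Odd f) as [[k Hk]|[k Hk]].
      - replace f with (4 + 2 * (k - 2))%nat by lia. eapply more_flips; eassumption.
      - replace f with (3 + 2 * (k - 1))%nat by lia. eapply more_flips; eassumption. }
    destruct K as (E & G & S & _).
    replace n with (f + (n - f))%nat by lia. eapply more_intervals; eassumption.
Qed.

(** * From interval exchanges to circle exchanges *)

Lemma mod1_spec (x : R) : exists k : Z, mod1 x = x - IZR k.
Proof. exists (Int_part x). reflexivity. Qed.

Lemma mod1_range (x : R) : 0 <= mod1 x < 1.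
Proof. unfold mod1. destruct (base_fp x). lra. Qed.

Lemma mod1_unique (x y : R) (k : Z) : 0 <= y < 1 -> x = y + IZR k -> mod1 x = y.
Proof.
  intros Hy E. destruct (mod1_spec x) as [m Hm]. pose proof (mod1_range x) as Hr.
  rewrite E in Hm at 2.
  assert (H : mod1 x = y + IZR (k - m)) by (rewrite minus_IZR; lra).
  assert (-1 < k - m)%Z by (apply lt_IZR; lra).
  assert (k - m < 1)%Z by (apply lt_IZR; lra).
  replace (k - m)%Z with 0%Z in H by lia. lra.
Qed.

Lemma mod1_id (x : R) : 0 <= x < 1 -> mod1 x = x.
Proof. intros H. apply (mod1_unique x x 0); [exact H|simpl; lra]. Qed.

Section Circle.
Context (E : exch) (V : valid E).
Local Notation L := (len E).
Local Notation n := (num E).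

Let c (i : nat) : R := cut E i / L.
Let t (i : nat) : R :=
  if flip E i then (start E i + cut E i) / L else (start E i - cut E i) / L.

(** The search makes [T] total; at a cut it falls back on a neighbouring branch, outside the domain
    of the exchange. *)
Fixpoint locate (k : nat) (x : R) : nat :=
  match k with
  | O => O
  | S k' => if Rlt_dec (cut E k') x then k' else locate k' x
  end.

Let T (x : R) : R := img E (locate n (L * x)) (L * x) / L.

Lemma len_pos : 0 < L.
Proof.
  pose proof (num_pos E V). pose proof (cut_lt E V 0 ltac:(lia)).
  pose proof (cut_range E 1 V ltac:(lia)). rewrite (cut_0 E V) in *. lra.
Qed.

Lemma locate_inner (k i : nat) (x : R) :
  (k <= n)%nat -> (i < k)%nat -> inner E i x -> locate k x = i.
Proof.
  induction k as [|k IH]; intros Hk Hi [H1 H2]; [lia|]. simpl.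
  destruct (Nat.eq_dec i k) as [->|Hn].
  - destruct (Rlt_dec (cut E k) x); [reflexivity|lra].
  - destruct (Rlt_dec (cut E k) x) as [l|l].
    + pose proof (cut_mono E (S i) k V ltac:(lia) ltac:(lia)). lra.
    + apply IH; [lia|lia|split; assumption].
Qed.

Lemma T_inner (i : nat) (x : R) :
  (i < n)%nat -> inner E i (L * x) -> T x = img E i (L * x) / L.
Proof. intros Hi Hx. unfold T. rewrite (locate_inner n i); auto. Qed.

Lemma c_lt (i : nat) (x : R) : c i < x <-> cut E i < L * x.
Proof.
  pose proof len_pos. unfold c. split; intros H'.
  - apply Rmult_lt_compat_r with (r := L) in H'; [|lra].
    replace (cut E i / L * L) with (cut E i) in H' by (field; lra). lra.
  - apply Rmult_lt_reg_r with L; [lra|].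
    replace (cut E i / L * L) with (cut E i) by (field; lra). lra.
Qed.

Lemma lt_c (i : nat) (x : R) : x < c i <-> L * x < cut E i.
Proof.
  pose proof len_pos. unfold c. split; intros H'.
  - apply Rmult_lt_compat_r with (r := L) in H'; [|lra].
    replace (cut E i / L * L) with (cut E i) in H' by (field; lra). lra.
  - apply Rmult_lt_reg_r with L; [lra|].
    replace (cut E i / L * L) with (cut E i) by (field; lra). lra.
Qed.

Lemma circ_scale (x : R) : 0 <= L * x < L -> circ_pt x.
Proof. pose proof len_pos. unfold circ_pt. split; nra. Qed.

Lemma c_0 : c 0%nat = 0.
Proof. pose proof len_pos. unfold c. rewrite (cut_0 E V). field. lra. Qed.

Lemma arc_inner (i : nat) (x : R) :
  (i < n)%nat -> in_arc n c i x <-> inner E i (L * x).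
Proof.
  intros Hi. pose proof len_pos as LP. unfold in_arc, inner.
  pose proof (cut_range E i V ltac:(lia)). pose proof (cut_range E (S i) V ltac:(lia)).
  destruct (Nat.ltb_spec (S i) n) as [Hs|Hs].
  - rewrite c_lt, lt_c. split; [tauto|]. intros H'. split; [|tauto].
    apply circ_scale. lra.
  - assert (i = n - 1)%nat as Hin by lia. rewrite <- Hin.
    replace (S i) with n in * by lia. fold L.
    (* As [c 0] is 0, the wrapping arc has no points below [c 0]. *)
    rewrite c_lt, c_0. unfold circ_pt. split.
    + intros [Hx [H'|H']]; split; nra.
    + intros H'. split; [|tauto]. split; nra.
Qed.

Lemma T_range (i : nat) (x : R) :
  (i < n)%nat -> inner E i (L * x) -> 0 < T x < 1.
Proof.
  intros Hi Hx. rewrite (T_inner i x Hi Hx).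
  pose proof (img_range E i _ V Hi Hx). pose proof len_pos.
  split.
  - apply Rdiv_lt_0_compat; lra.
  - apply Rmult_lt_reg_r with L; [lra|]. unfold Rdiv. rewrite Rmult_assoc, Rinv_l; lra.
Qed.

Lemma T_arc (i : nat) (x : R) : (i < n)%nat -> in_arc n c i x ->
  T x = if flip E i then mod1 (t i - x) else mod1 (x + t i).
Proof.
  intros Hi Hx. apply arc_inner in Hx; [|exact Hi].
  pose proof (T_range i x Hi Hx) as HT. pose proof (T_inner i x Hi Hx) as HT'.
  pose proof len_pos. unfold t, img in *.
  destruct (flip E i); symmetry; apply (mod1_unique _ _ 0); try lra;
    rewrite HT'; simpl; field; lra.
Qed.

Lemma dom_inner (x : R) :
  in_dom n c x <-> exists i, (i < n)%nat /\ inner E i (L * x).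
Proof.
  split; intros (i & Hi & Hx); exists i; (split; [exact Hi|]); apply arc_inner; assumption.
Qed.

Lemma T_inj (x y : R) : in_dom n c x -> in_dom n c y -> T x = T y -> x = y.
Proof.
  intros Dx Dy Heq. apply dom_inner in Dx as (i & Hi & Hx).
  apply dom_inner in Dy as (j & Hj & Hy). pose proof len_pos.
  rewrite (T_inner i x), (T_inner j y) in Heq by assumption.
  apply Rmult_eq_compat_r with (r := L) in Heq.
  unfold Rdiv in Heq. rewrite !Rmult_assoc, !Rinv_l, !Rmult_1_r in Heq by lra.
  assert (i = j) by (eapply (img_sep E V); eassumption). subst j.
  unfold img in Heq. assert (L * x = L * y) by (destruct (flip E i); lra).
  apply Rmult_eq_reg_l with L; lra.
Qed.

Lemma path_fwd (x y : R) : path E (L * x) y ->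
  exists m, fwd (in_dom n c) T m x (y / L).
Proof.
  pose proof len_pos.
  intros P. apply clos_rt_rt1n in P. remember (L * x) as x' eqn:Hx.
  revert x Hx. induction P as [x'|x' z y St P IH]; intros x ->.
  - exists 0%nat. simpl. field. lra.
  - destruct St as (i & Hi & Hin & ->).
    destruct (IH (T x)) as [m Hm].
    { rewrite (T_inner i x) by assumption. field. lra. }
    exists (S m). simpl. split; [|exact Hm].
    apply dom_inner. eauto.
Qed.

Lemma cdist_le (x y d : R) : Rabs (x - y) < d -> cdist x y < d.
Proof. intros H. eapply Rle_lt_trans; [apply Rmin_l|exact H]. Qed.

Lemma T_transitive : dense E -> transitive (in_dom n c) T.
Proof.
  intros (p & Hp & C). pose proof len_pos as LP.
  assert (Ep : L * (p / L) = p) by (field; lra).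
  exists (p / L). split; [apply circ_scale; lra|].
  intros x eps Hx Heps. destruct Hx as [Hx1 Hx2].
  destruct (C (L * x) (Rmin L (L * x + L * eps))) as [y [Hy P]].
  - nra.
  - apply Rmin_glb_lt; nra.
  - apply Rmin_l.
  - exists (y / L). split.
    + rewrite <- Ep in P. destruct (path_fwd _ _ P) as [m Hm]. exists m. left. exact Hm.
    + apply cdist_le. pose proof (Rmin_r L (L * x + L * eps)).
      assert (y = L * (y / L)) by (field; lra).
      rewrite Rabs_right; [|apply Rle_ge]; nra.
Qed.

Lemma apart_scale (x y : R) : 0 <= x <= L -> 0 <= y <= L -> apart L x y ->
  0 < Rabs (x / L - y / L) < 1.
Proof.
  intros Hx Hy (H1 & H2 & H3). pose proof len_pos as LP.
  assert (Ex : x = L * (x / L)) by (field; lra).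
  assert (Ey : y = L * (y / L)) by (field; lra).
  assert (K : 0 < Rabs (x - y) < L)
    by (unfold Rabs; destruct (Rcase_abs (x - y)); lra).
  replace (x / L - y / L) with ((x - y) / L) by (field; lra).
  unfold Rdiv. rewrite Rabs_mult, (Rabs_right (/ L));
    [|apply Rle_ge, Rlt_le, Rinv_0_lt_compat; lra].
  split.
  - apply Rmult_lt_0_compat; [lra|apply Rinv_0_lt_compat; lra].
  - apply Rmult_lt_reg_r with L; [lra|]. rewrite Rmult_assoc, Rinv_l; lra.
Qed.

(** The triangle inequality on the circle, for limits in [0, 1] where 0 and 1 are the same point;
    hence the second alternative. *)
Lemma two_limits (a b y eps u v : R) :
  0 <= a <= 1 -> 0 <= b <= 1 -> 0 <= y < 1 -> 0 < eps ->
  Rabs (u - a) < eps -> Rabs (v - b) < eps ->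
  cdist u y < eps -> cdist v y < eps ->
  Rabs (a - b) < 4 * eps \/ Rabs (a - b) > 1 - 4 * eps.
Proof.
  unfold cdist, Rmin. intros Ha Hb Hy He H1 H2 H3 H4.
  destruct (Rle_dec _ _) in H3; destruct (Rle_dec _ _) in H4;
  unfold Rabs in *; repeat destruct (Rcase_abs _); lra.
Qed.

Lemma near_start (i : nat) (eps delta : R) :
  (i < n)%nat -> 0 < eps -> 0 < delta ->
  exists x, in_dom n c x /\ Rabs (T x - start E i / L) < eps /\ c i < x < c i + delta.
Proof.
  intros Hi He Hd. pose proof len_pos as LP.
  pose proof (cut_lt E V i Hi) as W.
  set (h := Rmin (L * Rmin eps delta) (cut E (S i) - cut E i) / 2).
  pose proof (Rmin_l eps delta). pose proof (Rmin_r eps delta).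
  assert (0 < Rmin eps delta) by (apply Rmin_glb_lt; lra).
  assert (Hh : 0 < h /\ h < L * Rmin eps delta /\ h < cut E (S i) - cut E i).
  { unfold h. pose proof (Rmin_l (L * Rmin eps delta) (cut E (S i) - cut E i)).
    pose proof (Rmin_r (L * Rmin eps delta) (cut E (S i) - cut E i)).
    assert (0 < Rmin (L * Rmin eps delta) (cut E (S i) - cut E i))
      by (apply Rmin_glb_lt; nra). lra. }
  destruct Hh as (Hh1 & Hh2 & Hh3).
  set (x := (cut E i + h) / L).
  assert (Ex : L * x = cut E i + h) by (unfold x; field; lra).
  assert (Hx : inner E i (L * x)) by (unfold inner; lra).
  assert (Hr : h / L < Rmin eps delta)
    by (apply Rmult_lt_reg_r with L; [lra|]; unfold Rdiv; rewrite Rmult_assoc, Rinv_l; lra).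
  assert (Hr0 : 0 < h / L) by (apply Rdiv_lt_0_compat; lra).
  exists x. split; [apply dom_inner; eauto|]. split.
  - rewrite (T_inner i x) by assumption. rewrite Ex. unfold img.
    destruct (flip E i).
    + replace (_ - _) with (- (h / L)) by (field; lra). rewrite Rabs_Ropp, Rabs_right; lra.
    + replace (_ - _) with (h / L) by (field; lra). rewrite Rabs_right; lra.
  - unfold c, x. replace ((cut E i + h) / L) with (cut E i / L + h / L) by (field; lra). lra.
Qed.

Lemma near_stop (i : nat) (eps delta : R) :
  (i < n)%nat -> 0 < eps -> 0 < delta ->
  exists x, in_dom n c x /\ Rabs (T x - stop E i / L) < eps /\
            c (S i) - delta < x < c (S i).
Proof.
  intros Hi He Hd. pose proof len_pos as LP.
  pose proof (cut_lt E V i Hi) as W.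
  set (h := Rmin (L * Rmin eps delta) (cut E (S i) - cut E i) / 2).
  pose proof (Rmin_l eps delta). pose proof (Rmin_r eps delta).
  assert (0 < Rmin eps delta) by (apply Rmin_glb_lt; lra).
  assert (Hh : 0 < h /\ h < L * Rmin eps delta /\ h < cut E (S i) - cut E i).
  { unfold h. pose proof (Rmin_l (L * Rmin eps delta) (cut E (S i) - cut E i)).
    pose proof (Rmin_r (L * Rmin eps delta) (cut E (S i) - cut E i)).
    assert (0 < Rmin (L * Rmin eps delta) (cut E (S i) - cut E i))
      by (apply Rmin_glb_lt; nra). lra. }
  destruct Hh as (Hh1 & Hh2 & Hh3).
  set (x := (cut E (S i) - h) / L).
  assert (Ex : L * x = cut E (S i) - h) by (unfold x; field; lra).
  assert (Hx : inner E i (L * x)) by (unfold inner; lra).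
  assert (Hr : h / L < Rmin eps delta)
    by (apply Rmult_lt_reg_r with L; [lra|]; unfold Rdiv; rewrite Rmult_assoc, Rinv_l; lra).
  assert (Hr0 : 0 < h / L) by (apply Rdiv_lt_0_compat; lra).
  exists x. split; [apply dom_inner; eauto|]. split.
  - rewrite (T_inner i x) by assumption. rewrite Ex. unfold stop, img.
    destruct (flip E i).
    + replace (_ - _) with (h / L) by (field; lra). rewrite Rabs_right; lra.
    + replace (_ - _) with (- (h / L)) by (field; lra). rewrite Rabs_Ropp, Rabs_right; lra.
  - unfold c, x. replace ((cut E (S i) - h) / L) with (cut E (S i) / L - h / L)
      by (field; lra). lra.
Qed.

(* The left limit at [c i] is that of arc [k]; for [i = 0] this is the last arc,
   whose right end [1] is identified with [c 0 = 0]. *)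
Lemma no_extension (i k : nat) :
  (i < n)%nat -> (k < n)%nat ->
  (i = S k \/ i = 0%nat /\ k = (n - 1)%nat) ->
  apart L (stop E k) (start E i) -> ~ extends_cont_at (in_dom n c) T (c i).
Proof.
  intros Hi Hk Hik Ha (y & Hy & Hext). pose proof len_pos as LP.
  pose proof (start_range E V i Hi) as R1. pose proof (stop_range E V k Hk) as R2.
  pose proof (apart_scale _ _ R2 R1 Ha) as Hd.
  set (d := Rabs (stop E k / L - start E i / L)) in *.
  (* With 8 [eps] below both [d] and [1 - d], neither alternative of [two_limits] can hold. *)
  set (eps := Rmin d (1 - d) / 8).
  assert (He : 0 < eps /\ 8 * eps <= d /\ 8 * eps <= 1 - d).
  { unfold eps. pose proof (Rmin_l d (1 - d)). pose proof (Rmin_r d (1 - d)).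
    assert (0 < Rmin d (1 - d)) by (apply Rmin_glb_lt; lra). lra. }
  destruct (Hext eps ltac:(lra)) as (delta & Hdel & Hx).
  destruct (near_start i eps delta) as (u & Du & Tu & Cu); try assumption; [lra|].
  (* The cap 1 keeps [v] positive when its arc ends at 1, so that its circle distance to 0 is at
     most [1 - v]. *)
  destruct (near_stop k eps (Rmin delta 1)) as (v & Dv & Tv & Cv);
    try assumption; [lra|apply Rmin_glb_lt; lra|].
  pose proof (Rmin_l delta 1). pose proof (Rmin_r delta 1).
  assert (Xu : cdist u (c i) < delta) by (apply cdist_le; rewrite Rabs_right; lra).
  assert (Xv : cdist v (c i) < delta).
  { destruct Hik as [->|[-> ->]].
    - apply cdist_le. rewrite Rabs_left; lra.
    - replace (S (n - 1)) with n in Cv by (pose proof (num_pos E V); lia).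
      assert (c n = 1) as Hc by (unfold c; fold L; field; lra).
      rewrite Hc in Cv. rewrite c_0. eapply Rle_lt_trans; [apply Rmin_r|].
      rewrite Rabs_right; lra. }
  destruct (two_limits (stop E k / L) (start E i / L) y eps (T v) (T u)) as [K|K];
    try lra; try (apply Hx; assumption).
  - split; [apply Rle_mult_inv_pos; lra|].
    apply Rmult_le_reg_r with L; [lra|]. unfold Rdiv. rewrite Rmult_assoc, Rinv_l; lra.
  - split; [apply Rle_mult_inv_pos; lra|].
    apply Rmult_le_reg_r with L; [lra|]. unfold Rdiv. rewrite Rmult_assoc, Rinv_l; lra.
  - exact Hy.
  - fold d in K. lra.
  - fold d in K. lra.
Qed.

Lemma exch_CET : dense E ->
  exists (c' t' : nat -> R) (T' : R -> R),
    is_CET n c' t' (flip E) T' /\ transitive (in_dom n c') T'.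
Proof.
  intros HE. exists c, t, T. split; [|apply T_transitive; exact HE].
  pose proof (num_pos E V) as N. pose proof len_pos as LP.
  split; [exact N|]. split; [|split; [|split]].
  - split; [rewrite c_0; lra|]. split.
    + intros i Hi. apply c_lt. unfold c.
      replace (L * (cut E (S i) / L)) with (cut E (S i)) by (field; lra).
      apply (cut_lt E V). lia.
    + assert (cut E (n - 1) < L).
      { pose proof (cut_lt E V (n - 1) ltac:(lia)) as W.
        replace (S (n - 1)) with n in W by lia. exact W. }
      apply Rmult_lt_reg_r with L; [lra|]. unfold c, Rdiv.
      rewrite Rmult_assoc, Rinv_l; lra.
  - intros i x Hi Hx. apply T_arc; assumption.
  - exact T_inj.
  - intros i Hi. destruct (disc E V) as [D1 D2]. destruct i as [|i].
    + apply (no_extension 0 (n - 1)); auto. lia.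
    + apply (no_extension (S i) i); auto. lia.
Qed.

End Circle.

(** * Reversibility with a single flip *)

Section Orbits.
Context (D : R -> Prop) (T : R -> R).

Lemma fwd_add (m k : nat) (x z : R) :
  fwd D T (m + k) x z <-> exists y, fwd D T m x y /\ fwd D T k y z.
Proof.
  revert x. induction m as [|m IH]; intros x; simpl.
  - split; [intros H; eauto|intros (y & -> & H); exact H].
  - rewrite IH. split.
    + intros (Dx & y & H1 & H2). eauto.
    + intros (y & (Dx & H1) & H2). eauto.
Qed.

Lemma fwd_iter (m : nat) (x y : R) : fwd D T m x y -> y = Nat.iter m T x.
Proof.
  revert x. induction m as [|m IH]; intros x; simpl; [congruence|].
  intros [_ H]. rewrite (IH _ H). apply Nat.iter_swap.
Qed.

Lemma fwd_det (m : nat) (x y z : R) : fwd D T m x y -> fwd D T m x z -> y = z.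
Proof. intros H1 H2. apply fwd_iter in H1, H2. congruence. Qed.

(** Write tau x for kappa - T x. The hypothesis at T x reads T (tau (T x)) = tau x: tau conjugates
    [T] to its inverse, and so turns a path around. *)
Lemma fwd_reverse (kappa : R) :
  (forall x, D x -> D (mod1 (kappa - T x)) /\ T (mod1 (kappa - T x)) = mod1 (kappa - x)) ->
  forall m x y, D x -> D y -> fwd D T m x y ->
    fwd D T m (mod1 (kappa - T y)) (mod1 (kappa - T x)).
Proof.
  intros H m. induction m as [|m IH]; intros x y Dx Dy F; simpl in F.
  - rewrite F. reflexivity.
  - destruct F as [_ F].
    assert (D1 : D (T x)) by (destruct m; [simpl in F; rewrite F; exact Dy|apply F]).
    destruct (H _ D1) as [D2 E2].
    rewrite <- Nat.add_1_r. apply fwd_add.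
    exists (mod1 (kappa - T (T x))). split; [apply IH; assumption|].
    simpl. split; [exact D2|exact E2].
Qed.

Context (Tinj : forall x y, D x -> D y -> T x = T y -> x = y).

Lemma fwd_inj (m : nat) (x y z : R) : fwd D T m x z -> fwd D T m y z -> x = y.
Proof.
  revert x y. induction m as [|m IH]; intros x y; simpl; [congruence|].
  intros [Dx Hx] [Dy Hy]. auto.
Qed.

Lemma orbit_linked (p x y : R) : in_orbit D T p x -> in_orbit D T p y ->
  exists m, fwd D T m x y \/ fwd D T m y x.
Proof.
  assert (K1 : forall a b x y, (a <= b)%nat -> fwd D T a p x -> fwd D T b p y ->
    fwd D T (b - a) x y).
  { intros a b x' y' Hab H1 H2. replace b with (a + (b - a))%nat in H2 by lia.
    apply fwd_add in H2 as (z & H2 & H3).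
    rewrite (fwd_det _ _ _ _ H1 H2). exact H3. }
  assert (K2 : forall a b x y, (a <= b)%nat -> fwd D T a x p -> fwd D T b y p ->
    fwd D T (b - a) y x).
  { intros a b x' y' Hab H1 H2. replace b with (b - a + a)%nat in H2 by lia.
    apply fwd_add in H2 as (z & H2 & H3).
    rewrite (fwd_inj _ _ _ _ H1 H3). exact H2. }
  intros [a [Ha|Ha]] [b [Hb|Hb]].
  - destruct (Nat.le_ge_cases a b); eauto.
  - exists (b + a)%nat. right. apply fwd_add. eauto.
  - exists (a + b)%nat. left. apply fwd_add. eauto.
  - destruct (Nat.le_ge_cases a b); eauto.
Qed.

(** The cycle of [x] is closed under [T] and, by injectivity, under preimages; hence it contains the
    backward part of the orbit too. *)
Lemma periodic_orbit_finite (N : nat) (p x : R) :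
  (1 <= N)%nat -> fwd D T N x x -> in_orbit D T p x ->
  exists l, forall q, in_orbit D T p q -> In q l.
Proof.
  intros HN HP Hx.
  set (S u := exists a, (a < N)%nat /\ fwd D T a x u).
  assert (step1 : forall u, D u -> (S u <-> S (T u))).
  { intros u Du. split; intros (a & Ha & F).
    - assert (F' : fwd D T (a + 1) x (T u)) by (apply fwd_add; exists u; simpl; auto).
      destruct (Nat.eq_dec (a + 1) N) as [Heq|Hneq].
      + rewrite Heq in F'. rewrite (fwd_det _ _ _ _ F' HP).
        exists 0%nat. split; [lia|reflexivity].
      + exists (a + 1)%nat. split; [lia|exact F'].
    - assert (K : forall b, fwd D T (b + 1) x (T u) -> fwd D T b x u).
      { intros b Fb. apply fwd_add in Fb as (z & F1 & Dz & F2). simpl in F2.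
        rewrite <- (Tinj z u Dz Du F2). exact F1. }
      destruct a as [|a].
      (* Here [T u] is [x] itself, whose preimage on the cycle is reached after [N - 1] steps. *)
      + simpl in F. exists (N - 1)%nat. split; [lia|]. apply K.
        rewrite <- F. replace (N - 1 + 1)%nat with N by lia. exact HP.
      + exists a. split; [lia|]. apply K. rewrite Nat.add_1_r. exact F. }
  assert (steps : forall m u v, fwd D T m u v -> (S u <-> S v)).
  { intros m. induction m as [|m IH]; intros u v F; simpl in F.
    - rewrite F. reflexivity.
    - rewrite (step1 u) by apply F. apply IH. apply F. }
  assert (orb : forall q, in_orbit D T p q -> (S p <-> S q)).
  { intros q [m [F|F]]; [|symmetry]; eapply steps; exact F. }
  exists (map (fun a => Nat.iter a T x) (seq 0 N)). intros q Hq.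
  assert (Sx : S x) by (exists 0%nat; split; [lia|reflexivity]).
  apply orb in Hx, Hq. destruct (proj1 Hq (proj2 Hx Sx)) as (a & Ha & F).
  apply in_map_iff. exists a. split.
  - symmetry. exact (fwd_iter _ _ _ F).
  - apply in_seq. lia.
Qed.

End Orbits.

Lemma interval_avoiding (l : list R) (lo hi : R) : lo < hi ->
  exists lo' hi', lo <= lo' /\ lo' < hi' /\ hi' <= hi /\
    forall u, In u l -> ~ (lo' < u < hi').
Proof.
  intros H. induction l as [|v l (a & b & H1 & H2 & H3 & H4)].
  - exists lo, hi. repeat split; try lra. intros u [].
  - destruct (Rle_dec v ((a + b) / 2)).
    + exists ((a + b) / 2), b. repeat split; try lra.
      intros u [<-|Hu]; [lra|]. specialize (H4 u Hu). lra.
    + exists a, ((a + b) / 2). repeat split; try lra.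
      intros u [<-|Hu]; [lra|]. specialize (H4 u Hu). lra.
Qed.

(** * Congruence modulo 1 and removable discontinuities *)

Definition cong (x y : R) : Prop := exists k : Z, x = y + IZR k.

Lemma mod1_cong (x y : R) : cong x y -> mod1 x = mod1 y.
Proof.
  intros [k ->]. destruct (mod1_spec y) as [m Hm].
  apply (mod1_unique _ _ (m + k)); [apply mod1_range|]. rewrite plus_IZR. lra.
Qed.

Lemma cong_mod1 (x : R) : cong (mod1 x) x.
Proof. destruct (mod1_spec x) as [k Hk]. exists (- k)%Z. rewrite opp_IZR. lra. Qed.

Lemma cong_refl_eq (x y : R) : x = y -> cong x y.
Proof. intros ->. exists 0%Z. simpl. lra. Qed.

Lemma cong_sub (x y x' y' : R) : cong x y -> cong x' y' -> cong (x - x') (y - y').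
Proof. intros [k ->] [m ->]. exists (k - m)%Z. rewrite minus_IZR. lra. Qed.

Lemma cong_add (x y x' y' : R) : cong x y -> cong x' y' -> cong (x + x') (y + y').
Proof. intros [k ->] [m ->]. exists (k + m)%Z. rewrite plus_IZR. lra. Qed.

Lemma cdist_lift (x y e : R) : circ_pt x -> circ_pt y -> cdist x y < e ->
  exists m : Z, Rabs (x - y + IZR m) < e.
Proof.
  unfold circ_pt, cdist, Rmin. intros Hx Hy H.
  destruct (Rle_dec _ _) in H.
  - exists 0%Z. rewrite Rplus_0_r. exact H.
  - destruct (Rle_dec 0 (x - y)).
    + exists (-1)%Z. rewrite Rabs_right in H by lra. rewrite Rabs_left; lra.
    + exists 1%Z. rewrite Rabs_left in H by lra. rewrite Rabs_right; lra.
Qed.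

Lemma cdist_mod1 (a b e : R) (m : Z) :
  Rabs (a - b + IZR m) < e -> cdist (mod1 a) (mod1 b) < e.
Proof.
  intros H. destruct (mod1_spec a) as [k1 E1]. destruct (mod1_spec b) as [k2 E2].
  pose proof (mod1_range a). pose proof (mod1_range b).
  set (K := (k1 - k2 + m)%Z).
  assert (E : a - b + IZR m = mod1 a - mod1 b + IZR K)
    by (unfold K; rewrite plus_IZR, minus_IZR; lra).
  rewrite E in H. unfold cdist.
  assert (HK : (K <= -1)%Z \/ K = 0%Z \/ (1 <= K)%Z) by lia.
  destruct HK as [HK|[HK|HK]].
  - apply IZR_le in HK. eapply Rle_lt_trans; [apply Rmin_r|].
    unfold Rabs in *. repeat destruct (Rcase_abs _); lra.
  - rewrite HK, Rplus_0_r in H. eapply Rle_lt_trans; [apply Rmin_l|exact H].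
  - apply IZR_le in HK. eapply Rle_lt_trans; [apply Rmin_r|].
    unfold Rabs in *. repeat destruct (Rcase_abs _); lra.
Qed.

(** This will be applied at cuts, to exclude that the branches around one come from a single
    isometry. *)
Lemma isometry_extends (D : R -> Prop) (T : R -> R) (p kappa d : R) (rev : bool) :
  (forall x, D x -> circ_pt x) -> circ_pt p -> 0 < d ->
  (forall x, D x -> cdist x p < d ->
     T x = mod1 (if rev then kappa - x else x + kappa)) ->
  extends_cont_at D T p.
Proof.
  intros HD Hp Hd HT. exists (mod1 (if rev then kappa - p else p + kappa)).
  split; [apply mod1_range|]. intros eps He. exists (Rmin d eps).
  split; [apply Rmin_glb_lt; assumption|]. intros x Dx Hx.
  pose proof (Rmin_l d eps). pose proof (Rmin_r d eps).
  rewrite HT by (assumption || lra).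
  destruct (cdist_lift x p eps) as [m Hm]; [auto|assumption|lra|].
  destruct rev.
  - apply (cdist_mod1 _ _ _ (- m)). rewrite opp_IZR.
    replace (_ + _) with (- (x - p + IZR m)) by ring. rewrite Rabs_Ropp. exact Hm.
  - apply (cdist_mod1 _ _ _ m). replace (_ + _) with (x - p + IZR m) by ring. exact Hm.
Qed.

(** * Arcs of a circle exchange and the cyclic order of their images *)

Section Arcs.
Context (n : nat) (c t : nat -> R) (fl : nat -> bool) (T : R -> R).
Context (CET : is_CET n c t fl T).

(* Arc [i] lifts to the real interval from [c i] to [e i]. *)
Definition arc_end (n : nat) (c : nat -> R) (i : nat) : R :=
  if Nat.ltb (S i) n then c (S i) else c 0%nat + 1.
Local Notation e := (arc_end n c).

Lemma c_mono (i j : nat) : (i <= j)%nat -> (j < n)%nat -> c i <= c j.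
Proof.
  destruct CET as (_ & (_ & H & _) & _). intros Hij. induction Hij as [|j Hij IH]; intros Hj.
  - lra.
  - specialize (IH ltac:(lia)). specialize (H j Hj). lra.
Qed.

Lemma c_range (i : nat) : (i < n)%nat -> 0 <= c i < 1.
Proof.
  intros Hi. pose proof (c_mono 0 i ltac:(lia) Hi).
  pose proof (c_mono i (n - 1) ltac:(lia) ltac:(lia)).
  destruct CET as (_ & (H1 & _ & H2) & _). lra.
Qed.

Lemma arc_lt (i : nat) : (i < n)%nat -> c i < e i.
Proof.
  intros Hi. unfold arc_end. destruct (Nat.ltb_spec (S i) n) as [H|H].
  - destruct CET as (_ & (_ & H1 & _) & _). apply H1. exact H.
  - pose proof (c_range i Hi). pose proof (c_range 0 ltac:(lia)). lra.
Qed.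

Lemma arc_lift (i : nat) (x : R) : (i < n)%nat -> in_arc n c i x ->
  exists y, c i < y < e i /\ cong y x.
Proof.
  intros Hi [Hx H]. unfold circ_pt in Hx. unfold arc_end.
  pose proof (c_range 0 ltac:(lia)).
  destruct (Nat.ltb_spec (S i) n) as [Hs|Hs].
  - exists x. split; [exact H|]. apply cong_refl_eq. reflexivity.
  - assert (i = n - 1)%nat as -> by lia. pose proof (c_range (n - 1) ltac:(lia)).
    destruct H as [H|H].
    + exists x. split; [lra|]. apply cong_refl_eq. reflexivity.
    + exists (x + 1). split; [lra|]. exists 1%Z. reflexivity.
Qed.

Lemma arc_mod1 (i : nat) (y : R) : (i < n)%nat -> c i < y < e i -> in_arc n c i (mod1 y).
Proof.
  intros Hi. unfold arc_end, in_arc. pose proof (c_range i Hi).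
  pose proof (c_range 0 ltac:(lia)). intros Hy.
  split; [apply mod1_range|].
  destruct (Nat.ltb_spec (S i) n) as [Hs|Hs].
  - pose proof (c_range (S i) Hs). rewrite mod1_id by lra. exact Hy.
  - assert (n - 1 = i)%nat as -> by lia. destruct (Rlt_dec y 1).
    + rewrite mod1_id by lra. lra.
    + rewrite (mod1_unique y (y - 1) 1) by (simpl; lra). lra.
Qed.

Lemma arc_disjoint (i j : nat) (x : R) : (i < n)%nat -> (j < n)%nat ->
  in_arc n c i x -> in_arc n c j x -> i = j.
Proof.
  assert (K : forall i j, (i < j)%nat -> (j < n)%nat -> in_arc n c i x ->
    in_arc n c j x -> False).
  { intros a b Hab Hb [_ Ha] [_ Hb']. destruct (Nat.ltb_spec (S a) n); [|lia].
    pose proof (c_mono 0 a ltac:(lia) ltac:(lia)).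
    pose proof (c_mono (S a) b ltac:(lia) ltac:(lia)).
    pose proof (c_mono b (n - 1) ltac:(lia) ltac:(lia)).
    destruct (Nat.ltb_spec (S b) n); lra. }
  intros Hi Hj H1 H2. destruct (Nat.lt_trichotomy i j) as [H|[H|H]]; [|exact H|];
    exfalso; eapply K; eauto.
Qed.

Lemma dom_circ (x : R) : in_dom n c x -> circ_pt x.
Proof. intros (i & _ & H & _). exact H. Qed.

Lemma T_lift (i : nat) (y : R) : (i < n)%nat -> c i < y < e i ->
  T (mod1 y) = mod1 (if fl i then t i - y else y + t i).
Proof.
  intros Hi Hy. destruct CET as (_ & _ & HT & _).
  rewrite (HT i) by (exact Hi || apply arc_mod1; assumption).
  destruct (fl i); apply mod1_cong.
  - apply cong_sub; [apply cong_refl_eq; reflexivity|apply cong_mod1].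
  - apply cong_add; [apply cong_mod1|apply cong_refl_eq; reflexivity].
Qed.

(* Up to integers, arc [i] is mapped onto the interval of length [e i - c i]
   starting at [image i]. *)
Definition image (i : nat) : R := if fl i then t i - e i else c i + t i.

Lemma images_disjoint (i j : nat) (u v : R) : (i < n)%nat -> (j < n)%nat -> i <> j ->
  0 < u < e i - c i -> 0 < v < e j - c j -> ~ cong (image i + u) (image j + v).
Proof.
  intros Hi Hj Hij Hu Hv HC.
  assert (K : forall k w, (k < n)%nat -> 0 < w < e k - c k ->
    exists y, c k < y < e k /\ T (mod1 y) = mod1 (image k + w)).
  { intros k w Hk Hw. exists (if fl k then e k - w else c k + w).
    assert (Hy : c k < (if fl k then e k - w else c k + w) < e k) by (destruct (fl k); lra).
    split; [exact Hy|]. rewrite (T_lift k) by assumption. unfold image.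
    destruct (fl k); f_equal; ring. }
  destruct (K i u Hi Hu) as (x & Hx & Ex). destruct (K j v Hj Hv) as (y & Hy & Ey).
  apply mod1_cong in HC. rewrite <- Ex, <- Ey in HC.
  pose proof (arc_mod1 i x Hi Hx) as Ax. pose proof (arc_mod1 j y Hj Hy) as Ay.
  destruct CET as (_ & _ & _ & Tinj & _).
  apply Tinj in HC; [|exists i; auto|exists j; auto].
  rewrite HC in Ax. apply Hij. eapply arc_disjoint; eassumption.
Qed.

(** Once the circle is cut open at the start of the image of arc [i], disjointness leaves only this
    window for the image of arc [j]. *)
Lemma images_gap (i j : nat) : (i < n)%nat -> (j < n)%nat -> i <> j ->
  exists k : Z, image i + (e i - c i) <= image j + IZR k <= image i + 1 - (e j - c j).
Proof.
  intros Hi Hj Hij. pose proof (arc_lt i Hi). pose proof (arc_lt j Hj).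
  set (wi := e i - c i). set (wj := e j - c j).
  pose proof (images_disjoint i j) as K. fold wi wj in K.
  destruct (mod1_spec (image j - image i)) as [m Hm].
  pose proof (mod1_range (image j - image i)).
  exists (- m)%Z. rewrite opp_IZR. set (d := image j + - IZR m).
  assert (Hd : image i <= d < image i + 1) by (unfold d; lra).
  destruct (Rle_dec (image i + wi) d) as [l1|l1];
    [destruct (Rle_dec d (image i + 1 - wj)) as [l2|l2]; [split; assumption|]|];
    exfalso.
  (* The image of arc [j] would run past [image i + 1] into the next lift of the image of arc [i];
     the midpoint of the overlap is a common point. *)
  - set (z := Rmin (d + wj) (image i + 1 + wi)).
    pose proof (Rmin_l (d + wj) (image i + 1 + wi)) as M1.
    pose proof (Rmin_r (d + wj) (image i + 1 + wi)) as M2. fold z in M1, M2.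
    assert (image i + 1 < z) by (apply Rmin_glb_lt; unfold wi; lra).
    apply (K ((z + (image i + 1)) / 2 - (image i + 1)) ((z + (image i + 1)) / 2 - d));
      try assumption; try lra.
    exists (- m - 1)%Z. rewrite minus_IZR, opp_IZR. unfold d. lra.
  - set (z := Rmin (d + wj) (image i + wi)).
    pose proof (Rmin_l (d + wj) (image i + wi)) as M1.
    pose proof (Rmin_r (d + wj) (image i + wi)) as M2. fold z in M1, M2.
    assert (d < z) by (apply Rmin_glb_lt; unfold wj; lra).
    apply (K ((z + d) / 2 - image i) ((z + d) / 2 - d)); try assumption; try lra.
    exists (- m)%Z. rewrite opp_IZR. unfold d. lra.
Qed.

Lemma orbit_circ (p q : R) : circ_pt p -> in_orbit (in_dom n c) T p q -> circ_pt q.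
Proof.
  assert (K : forall m x y, circ_pt x -> fwd (in_dom n c) T m x y -> circ_pt y).
  { intros m. induction m as [|m IH]; intros x y Hx F; simpl in F; [congruence|].
    destruct F as [(i & Hi & Ha) F]. apply IH in F; [exact F|].
    destruct CET as (_ & _ & HT & _). rewrite (HT i x Hi Ha).
    destruct (fl i); apply mod1_range. }
  intros Hp [m [F|F]]; [eapply K; eassumption|].
  destruct m; simpl in F; [congruence|]. apply dom_circ. apply F.
Qed.

Lemma orbit_hits (p : R) : circ_pt p ->
  (forall x eps, circ_pt x -> 0 < eps ->
     exists q, in_orbit (in_dom n c) T p q /\ cdist q x < eps) ->
  forall lo hi, 0 <= lo -> lo < hi -> hi <= 1 ->
    exists q, in_orbit (in_dom n c) T p q /\ lo < q < hi.
Proof.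
  intros Hp HT lo hi H1 H2 H3.
  destruct (HT ((lo + hi) / 2) ((hi - lo) / 2)) as (q & Hq & Hd);
    [unfold circ_pt; lra|lra|].
  exists q. split; [exact Hq|]. apply orbit_circ in Hq; [|exact Hp].
  unfold circ_pt in Hq. revert Hd. unfold cdist, Rmin, Rabs.
  destruct (Rcase_abs _), (Rle_dec _ _); lra.
Qed.

(* [T] is the composition of the reflection [x |-> t i - x] of the circle with the
   involution [x |-> t i - T x], which is the identity on arc [i] and reflects
   the other arcs in place. *)
Lemma single_flip_not_transitive (i : nat) : (i < n)%nat -> fl i = true ->
  (forall j, (j < n)%nat -> j <> i -> fl j = false /\ cong (t j) (t i - c j - e j)) ->
  ~ transitive (in_dom n c) T.
Proof.
  intros Hi Fi Hj (p & Hp & HT).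
  set (D := in_dom n c) in *. set (kappa := t i) in *.
  assert (HTarc := proj1 (proj2 (proj2 CET))).
  assert (Tinj := proj1 (proj2 (proj2 (proj2 CET)))). fold D in Tinj.
  assert (fixed : forall x, in_arc n c i x -> mod1 (kappa - T x) = x).
  { intros x Hx. rewrite (HTarc i x Hi Hx), Fi.
    destruct (mod1_spec (t i - x)) as [m Hm].
    apply (mod1_unique _ _ m); [apply Hx|]. unfold kappa. lra. }
  assert (rev : forall x, D x ->
    D (mod1 (kappa - T x)) /\ T (mod1 (kappa - T x)) = mod1 (kappa - x)).
  { intros x (j & Hjn & Hx). destruct (Nat.eq_dec j i) as [->|Hji].
    - rewrite fixed by exact Hx. split; [exists i; auto|].
      rewrite (HTarc i x Hi Hx), Fi. reflexivity.
    - destruct (Hj j Hjn Hji) as [Fj [m Cj]].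
      destruct (arc_lift j x Hjn Hx) as (y & Hy & [k Ey]).
      assert (E1 : mod1 (kappa - T x) = mod1 (c j + e j - y)).
      { apply mod1_cong. rewrite (HTarc j x Hjn Hx), Fj.
        destruct (mod1_spec (x + t j)) as [r Hr]. exists (k - m + r)%Z.
        rewrite plus_IZR, minus_IZR, Hr, Cj, Ey. ring. }
      rewrite E1. split.
      + exists j. split; [exact Hjn|]. apply arc_mod1; [exact Hjn|lra].
      + rewrite (T_lift j) by (exact Hjn || lra). rewrite Fj. apply mod1_cong.
        exists (m - k)%Z. rewrite minus_IZR, Cj, Ey. ring. }
  assert (hits := orbit_hits p Hp HT).
  assert (A : exists lo hi, 0 <= lo /\ lo < hi /\ hi <= 1 /\
    forall x, lo < x < hi -> in_arc n c i x).
  { pose proof (c_range i Hi) as Ri. pose proof (arc_lt i Hi) as Wi. unfold arc_end in Wi.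
    unfold in_arc, circ_pt. destruct (Nat.ltb_spec (S i) n) as [Hs|Hs].
    - pose proof (c_range (S i) Hs). exists (c i), (c (S i)).
      repeat split; lra.
    - exists (c i), 1. replace (n - 1)%nat with i by lia. repeat split; lra. }
  destruct A as (lo & hi & A1 & A2 & A3 & A4).
  (* One orbit point from each half of the arc: they differ, so the path linking them has at least
     one step. *)
  destruct (hits lo ((lo + hi) / 2)) as (x & Ox & Hx); try lra.
  destruct (hits ((lo + hi) / 2) hi) as (y & Oy & Hy); try lra.
  assert (Ax : in_arc n c i x) by (apply A4; lra).
  assert (Ay : in_arc n c i y) by (apply A4; lra).
  assert (P : forall m x y, x <> y -> in_arc n c i x -> in_arc n c i y ->
    fwd D T m x y -> exists N, (1 <= N)%nat /\ fwd D T N x x).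
  { intros m u v Huv Au Av F. exists (m + m)%nat. split.
    - destruct m; [simpl in F; contradiction|lia].
    - apply fwd_add. exists v. split; [exact F|].
      pose proof (fwd_reverse D T kappa rev m u v) as R.
      rewrite (fixed u Au), (fixed v Av) in R.
      apply R; [exists i; auto|exists i; auto|exact F]. }
  assert (Q : exists N z, (1 <= N)%nat /\ fwd D T N z z /\ in_orbit D T p z).
  { destruct (orbit_linked D T Tinj p x y Ox Oy) as [m [F|F]];
      apply P in F; try assumption; try lra; destruct F as (N & HN & F); eauto. }
  destruct Q as (N & z & HN & F & Oz).
  destruct (periodic_orbit_finite D T Tinj N p z HN F Oz) as [l Hl].
  destruct (interval_avoiding l 0 1 ltac:(lra)) as (a & b & B1 & B2 & B3 & B4).
  destruct (hits a b B1 B2 B3) as (q & Oq & Hq).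
  exact (B4 q (Hl q Oq) Hq).
Qed.

Lemma no_global_reflection (kappa : R) :
  (forall i, (i < n)%nat -> fl i = true /\ cong (t i) kappa) -> False.
Proof.
  intros H. assert (N := proj1 CET).
  destruct CET as (_ & _ & HT & _ & Hext). apply (Hext 0%nat ltac:(lia)).
  apply (isometry_extends _ _ _ kappa 1 true); [apply dom_circ| |lra|].
  - apply c_range. lia.
  - intros x (i & Hi & Hx) _. rewrite (HT i x Hi Hx).
    destruct (H i Hi) as [-> HC]. apply mod1_cong.
    apply cong_sub; [exact HC|apply cong_refl_eq; reflexivity].
Qed.

(** When the lengths fill the circle, the window of [images_gap] shrinks to a point. *)
Lemma two_arcs (i j : nat) : (i < n)%nat -> (j < n)%nat -> i <> j ->
  (e i - c i) + (e j - c j) = 1 -> cong (image j) (image i + (e i - c i)).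
Proof.
  intros Hi Hj Hij H. destruct (images_gap i j Hi Hj Hij) as [k Hk].
  exists (- k)%Z. rewrite opp_IZR. lra.
Qed.

Lemma three_arcs (i j k : nat) : (i < n)%nat -> (j < n)%nat -> (k < n)%nat ->
  i <> j -> i <> k -> j <> k ->
  (e i - c i) + (e j - c j) + (e k - c k) = 1 ->
  (cong (image j) (image i + (e i - c i)) /\ cong (image k) (image j + (e j - c j))) \/
  (cong (image k) (image i + (e i - c i)) /\ cong (image j) (image k + (e k - c k))).
Proof.
  intros Hi Hj Hk Hij Hik Hjk H.
  pose proof (arc_lt i Hi). pose proof (arc_lt j Hj). pose proof (arc_lt k Hk).
  destruct (images_gap i j Hi Hj Hij) as [a Ha].
  destruct (images_gap i k Hi Hk Hik) as [b Hb].
  destruct (images_gap j k Hj Hk Hjk) as [m Hm].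
  (* [r] compares the three lifts. The windows allow only 0 and -1, the two cyclic orders i, j, k
     and i, k, j. *)
  set (r := (b - a - m)%Z).
  assert (Er : IZR b = IZR a + IZR m + IZR r) by (unfold r; rewrite !minus_IZR; lra).
  assert (R1 : (r < 1)%Z) by (apply lt_IZR; lra).
  assert (R2 : (-2 < r)%Z) by (apply lt_IZR; lra).
  assert (R3 : r = 0%Z \/ r = (-1)%Z) by lia.
  destruct R3 as [R3|R3]; rewrite R3 in Er; [left|right]; split.
  - exists (- a)%Z. rewrite opp_IZR. lra.
  - exists (a - b)%Z. rewrite minus_IZR. lra.
  - exists (- b)%Z. rewrite opp_IZR. lra.
  - exists (b - a)%Z. rewrite minus_IZR. lra.
Qed.

(* Otherwise [T] would be a rotation near [c k]. *)
Lemma translations_differ (i j k : nat) : (i < n)%nat -> (j < n)%nat -> (k < n)%nat ->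
  (forall l, (l < n)%nat -> l = i \/ l = j \/ l = k) ->
  fl j = false -> fl k = false -> cong (c j) (e i) -> cong (c k) (e j) ->
  (e i - c i) + (e j - c j) + (e k - c k) = 1 ->
  ~ cong (t k) (t j).
Proof.
  intros Hi Hj Hk All Fj Fk [a1 C1] [a2 C2] HW HC.
  pose proof (arc_lt i Hi). pose proof (arc_lt j Hj). pose proof (arc_lt k Hk).
  assert (Rk : circ_pt (c k)) by (apply c_range; exact Hk).
  destruct CET as (_ & _ & HT & _ & Hext). apply (Hext k Hk).
  set (d := Rmin (e j - c j) (e k - c k)).
  pose proof (Rmin_l (e j - c j) (e k - c k)) as M1.
  pose proof (Rmin_r (e j - c j) (e k - c k)) as M2. fold d in M1, M2.
  assert (M0 : 0 < d) by (apply Rmin_glb_lt; lra).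
  apply (isometry_extends _ _ _ (t j) d false); [apply dom_circ|exact Rk|exact M0|].
  intros x (l & Hl & Hx) Hd. rewrite (HT l x Hl Hx).
  destruct (All l Hl) as [-> | [-> | ->]].
  (* Arcs [j] and [k] flank [c k] and are at least [d] long, so arc [i] stays outside the ball; the
     sign of [r] tells on which side. *)
  - exfalso. apply cdist_lift in Hd as [m Hm]; [|apply Hx|exact Rk].
    destruct (arc_lift i x Hi Hx) as (y & Hy & [b Ey]).
    set (r := (m - b - a1 - a2)%Z).
    assert (Er : x - c k + IZR m = y - e i - (e j - c j) + IZR r)
      by (unfold r; rewrite !minus_IZR; lra).
    rewrite Er in Hm. apply Rabs_def2 in Hm.
    assert (R1 : (r <= 0)%Z \/ (1 <= r)%Z) by lia.
    destruct R1 as [R1|R1]; apply IZR_le in R1; lra.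
  - rewrite Fj. reflexivity.
  - rewrite Fk. apply mod1_cong.
    apply cong_add; [apply cong_refl_eq; reflexivity|exact HC].
Qed.

(** If the images keep the cyclic order i, j, k, then arcs [j] and [k] are adjacent before and
    after, hence translated alike, and their common cut is removable. In the reversed order,
    adjacency of the images gives the translations required by [single_flip_not_transitive]. *)
Lemma three_arcs_not_transitive (i j k : nat) : (i < n)%nat -> (j < n)%nat -> (k < n)%nat ->
  i <> j -> i <> k -> j <> k ->
  (forall l, (l < n)%nat -> l = i \/ l = j \/ l = k) ->
  fl i = true -> fl j = false -> fl k = false ->
  cong (c j) (e i) -> cong (c k) (e j) -> cong (c i) (e k) ->
  (e i - c i) + (e j - c j) + (e k - c k) = 1 ->
  ~ transitive (in_dom n c) T.
Proof.
  intros Hi Hj Hk Hij Hik Hjk All Fi Fj Fk C1 C2 C3 HW.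
  pose proof (translations_differ i j k Hi Hj Hk All Fj Fk C1 C2 HW) as ND.
  destruct C1 as [a1 C1], C2 as [a2 C2], C3 as [a3 C3].
  destruct (three_arcs i j k) as [[[b1 I1] [b2 I2]]|[[b1 I1] [b2 I2]]]; try assumption;
    unfold image in I1, I2; rewrite ?Fi, ?Fj, ?Fk in *.
  - exfalso. apply ND. exists (b2 - a2)%Z. rewrite minus_IZR. lra.
  - apply (single_flip_not_transitive i Hi Fi). intros l Hl Hli.
    destruct (All l Hl) as [-> | [-> | ->]];
      [contradiction|split; [assumption|]|split; [assumption|]].
    + exists (b1 + b2 - a2 - a3)%Z. rewrite !minus_IZR, plus_IZR. lra.
    + exists (b1 - a3)%Z. rewrite minus_IZR. lra.
Qed.

End Arcs.

Lemma few_intervals_not_transitive (n f : nat) (c t : nat -> R) (fl : nat -> bool) (T : R -> R) :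
  (1 <= f)%nat -> (f <= n)%nat -> (n + f < 5)%nat ->
  is_CET n c t fl T -> nflips n fl = f -> ~ transitive (in_dom n c) T.
Proof.
  intros Hf Hn H5 CET Hfl.
  assert (Hc : (n = 1 /\ f = 1 \/ n = 2 /\ f = 1 \/ n = 2 /\ f = 2 \/ n = 3 /\ f = 1)%nat)
    by lia.
  assert (cr : forall x, cong x x) by (intros; apply cong_refl_eq; reflexivity).
  assert (c1 : forall x, cong x (x + 1)) by (intros x; exists (-1)%Z; simpl; lra).
  destruct Hc as [[-> ->]|[[-> ->]|[[-> ->]|[-> ->]]]];
    rewrite !nflips_S in Hfl; change (nflips 0 fl) with 0%nat in Hfl; simpl in Hfl.
  - exfalso. apply (no_global_reflection _ _ _ _ _ CET (t 0%nat)).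
    intros i Hi. assert (i = 0)%nat as -> by lia. split; [|apply cr].
    destruct (fl 0%nat); [reflexivity|discriminate].
  - pose proof (two_arcs _ _ _ _ _ CET 0 1 ltac:(lia) ltac:(lia) ltac:(lia)) as K01.
    pose proof (two_arcs _ _ _ _ _ CET 1 0 ltac:(lia) ltac:(lia) ltac:(lia)) as K10.
    unfold image, arc_end in *; simpl in *.
    destruct (fl 0%nat) eqn:F0, (fl 1%nat) eqn:F1; try discriminate.
    + apply (single_flip_not_transitive _ _ _ _ _ CET 0 ltac:(lia) F0).
      intros j Hj Hj0. assert (j = 1)%nat as -> by lia. split; [exact F1|].
      unfold arc_end; simpl. destruct K01 as [k Hk]; [lra|].
      exists (k + 1)%Z. rewrite plus_IZR. lra.
    + apply (single_flip_not_transitive _ _ _ _ _ CET 1 ltac:(lia) F1).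
      intros j Hj Hj0. assert (j = 0)%nat as -> by lia. split; [exact F0|].
      unfold arc_end; simpl. destruct K10 as [k Hk]; [lra|].
      exists k. lra.
  (* Two flipped arcs with adjacent images are restrictions of the same reflection. *)
  - exfalso. apply (no_global_reflection _ _ _ _ _ CET (t 0%nat)).
    pose proof (two_arcs _ _ _ _ _ CET 0 1 ltac:(lia) ltac:(lia) ltac:(lia)) as K01.
    unfold image, arc_end in *; simpl in *.
    destruct (fl 0%nat) eqn:F0, (fl 1%nat) eqn:F1; try discriminate.
    intros i Hi. assert (Hi' : (i = 0 \/ i = 1)%nat) by lia.
    destruct Hi' as [->| ->]; (split; [assumption|]); [apply cr|].
    destruct K01 as [k Hk]; [lra|]. exists (k + 1)%Z. rewrite plus_IZR. lra.
  (* Three distinct naturals with sum 3 and product 0 are 0, 1 and 2 in some order. *)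
  - assert (All : forall a b d : nat, (a + b + d = 3)%nat -> (a * b * d = 0)%nat ->
      a <> b -> b <> d -> a <> d ->
      forall l, (l < 3)%nat -> l = a \/ l = b \/ l = d) by (intros; nia).
    destruct (fl 0%nat) eqn:F0, (fl 1%nat) eqn:F1, (fl 2%nat) eqn:F2; try discriminate;
      [apply (three_arcs_not_transitive _ _ _ _ _ CET 0 1 2)
      |apply (three_arcs_not_transitive _ _ _ _ _ CET 1 2 0)
      |apply (three_arcs_not_transitive _ _ _ _ _ CET 2 0 1)];
      try assumption; try lia; unfold arc_end; simpl; try apply cr; try apply c1; try lra.
Qed.

Theorem theoremA (n f : nat) (Hf : (1 <= f)%nat) (Hfn : (f <= n)%nat) :
  (exists (c t : nat -> R) (fl : nat -> bool) (T : R -> R),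
      is_CET n c t fl T /\ nflips n fl = f /\ transitive (in_dom n c) T)
  <-> (5 <= n + f)%nat.
Proof.
  split.
  - intros (c & t & fl & T & HC & HF & HT).
    destruct (Nat.le_gt_cases 5 (n + f)) as [H|H]; [exact H|].
    exfalso. exact (few_intervals_not_transitive n f c t fl T Hf Hfn H HC HF HT).
  - intros H. destruct (exists_good n f Hf Hfn H) as (E & V & HE & <- & HF).
    destruct (exch_CET E V HE) as (c & t & T & HC & HT).
    exists c, t, (flip E), T. auto.
Qed.
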